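(* Let $\alpha\ge-1/2$ and let $\nu,\mu\in\mathbb{R}$ be such that $0<\mu+\nu\le\alpha+3/2$. Let $f:\mathbb{R}_+\to\mathbb{C}$ be vanishing at infinity and such that $t^\nu f(t)\in L^1(0,1)$. Assume that $$\int_M^\infty |df(t)|=o\big(M^{\mu-1}\big)\ \text{ as }M\to\infty,\qquad\text{if }\nu<\alpha+1/2\text{ and }\mu<1,$$ $$\int_M^\infty t^{\nu-\alpha-1/2}\,|df(t)|=o\big(M^{\mu+\nu-\alpha-3/2}\big)\ \text{ as }M\to\infty,\qquad\text{if }\nu\ge\alpha+1/2\text{ or }\mu\ge1.$$ Then $\mathcal{L}^{\alpha}_{\nu,\mu}f$ converges uniformly on $\mathbb{R}_+$.
   Context: $\mathbb{R}_+=[0,\infty)$. For $\alpha\ge-1/2$, $j_\alpha(z)=\Gamma(\alpha+1)(z/2)^{-\alpha}J_\alpha(z)$ is the normalized Bessel function, where $J_\alpha$ is the Bessel function of the first kind of order $\alpha$ (so $j_\alpha(0)=1$). Standing assumption: $f:\mathbb{R}_+\to\mathbb{C}$ is locally of bounded variation and locally integrable on $(0,\infty)$. Integrals against $|df(t)|$ are Stieltjes integrals with respect to the total variation of $f$. ''Vanishing at infinity'' means $f(t)\to0$ as $t\to\infty$. The transform is $\mathcal{L}^{\alpha}_{\nu,\mu}f(r)=r^\mu\int_0^\infty (rt)^\nu f(t)j_\alpha(rt)\,dt$, where $\int_0^\infty=\lim_{N\to\infty}\int_0^N$ and $r^\mu(rt)^\nu$ is read as $r^{\mu+\nu}t^\nu$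 (so when $\mu+\nu>0$ the partial integrals are $0$ at $r=0$). It converges uniformly on a set $E\subset\mathbb{R}_+$ if the partial integrals $r^{\mu}\int_0^N (rt)^\nu f(t)j_\alpha(rt)\,dt$ converge uniformly in $r\in E$ as $N\to\infty$, equivalently $r^{\mu}\int_M^N (rt)^\nu f(t)j_\alpha(rt)\,dt\to0$ uniformly in $r\in E$ as $N>M\to\infty$. *)

(* Defs.v *)
From HB Require Import structures.
From mathcomp Require Import all_boot all_order all_algebra.
From mathcomp Require Import all_classical all_reals all_analysis.
From mathcomp Require Import complex.

Set Implicit Arguments.
Unset Strict Implicit.
Unset Printing Implicit Defensive.

Import Order.TTheory GRing.Theory Num.Theory.
Import numFieldNormedType.Exports.

Local Open Scope classical_set_scope.
Local Open Scope ring_scope.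
Local Open Scope complex_scope.

Local Notation leb := lebesgue_measure.

Section bessel.
Context {R : realType}.
Implicit Types (alpha x z : R) (k : nat).

(* Meaningful for [0 < x] only: [Rintegral] is 0 on divergent integrals. Hence
   [besselJ] below is meant for [-1 < alpha] and [0 < z]. *)
Definition Gamma x : R :=
  \int[leb]_(t in `]0%R, +oo[) (t `^ (x - 1) * expR (- t)).

Definition besselJ_coef alpha z k : R :=
  (-1) ^+ k / (k`!%:R * Gamma (k%:R + alpha + 1))
    * (z / 2) `^ (2 * k%:R + alpha).

Definition besselJ alpha z : R := limn (series (besselJ_coef alpha z)).

(* The defining formula is meaningless at [z = 0], where the value is given by
   continuity. *)
Definition bessel_j alpha z : R :=
  if z == 0 then 1
  else Gamma (alpha + 1) * (z / 2) `^ (- alpha) * besselJ alpha z.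

End bessel.

(* Functions on [0, +oo[ are represented by functions on [R], whose values at
   negative arguments are never used. *)

Section complex_integration.
Context {R : realType}.
Implicit Types (D : set R) (f : R -> R[i]).

Definition cintegrable D f :=
  leb.-integrable D (fun t => (complex.Re (f t))%:E) /\
  leb.-integrable D (fun t => (complex.Im (f t))%:E).

Definition clocally_integrable D f :=
  locally_integrable D (fun t => complex.Re (f t)) /\
  locally_integrable D (fun t => complex.Im (f t)).

Definition cintegral D f : R[i] :=
  (\int[leb]_(t in D) complex.Re (f t)) +i* (\int[leb]_(t in D) complex.Im (f t)).

End complex_integration.

(* The library's [variation], [bounded_variation] and [total_variation] are
   restricted to real-valued functions. *)

Section complex_variation.
Context {R : realType}.
Implicit Types (f : R -> R[i]) (a b M t : R).

Definition cvariation a b f (s : seq R) : R :=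
  let F := f \o nth b (a :: s) in
  \sum_(0 <= n < size s) Normc.normc (F n.+1 - F n).

Definition cvariations a b f : set R :=
  [set cvariation a b f s | s in itv_partition a b].

Definition cbounded_variation a b f := has_ubound (cvariations a b f).

Definition ctotal_variation a b f : \bar R :=
  ereal_sup [set x%:E | x in cvariations a b f].

Definition locally_bounded_variation f :=
  forall a b, 0 < a -> a < b -> cbounded_variation a b f.

(* Total variation of [f] on [M, t], extended by 0 to the left of [M]. The
   value 0 in the second branch is junk: it makes the function nondecreasing
   also when [f] is not of bounded variation on the bounded subintervals
   of [M, +oo[. *)
Definition tv_from f M t : R :=
  if `[< forall b, M < b -> cbounded_variation M b f >] && (M <= t)
  then fine (ctotal_variation M t f) else 0.

(* [f] need not be right-continuous, whereas Lebesgue-Stieltjes measures are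
   defined from right-continuous functions. The measure obtained from the right
   limits of [tv_from f M] has mass [|f(M+) - f(M)|] at [M], so that its integrals
   over [M, +oo[ are the Stieltjes integrals against [|df|] from [M] to
   infinity. *)
Definition tv_from_right f M t : R := lim (tv_from f M s @[s --> t^'+]).

Lemma cvariation_ge0 a b f s : 0 <= cvariation a b f s.
Proof.
by rewrite /cvariation sumr_ge0// => i _; case: (_ - _) => x y; exact: sqrtr_ge0.
Qed.

Lemma ctotal_variation_ge0 a b f : a <= b -> (0 <= ctotal_variation a b f)%E.
Proof.
rewrite le_eqVlt => /predU1P[<-|ab].
  apply: ereal_sup_ubound => /=; exists 0 => //; exists [::].
    by split => /=.
  by rewrite /cvariation big_nil.
apply: (@le_trans _ _ (cvariation a b f [:: b])%:E).
  by rewrite lee_fin cvariation_ge0.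
apply: ereal_sup_ubound => /=; exists (cvariation a b f [:: b]) => //.
by exists [:: b] => //; exact: itv_partition1.
Qed.

Lemma cvariation_rcons a b c f s : itv_partition a b s ->
  cvariation a c f (rcons s c)
    = cvariation a b f s + Normc.normc (f c - f b).
Proof.
move=> [_ /eqP lasts]; rewrite /cvariation size_rcons big_nat_recr//=.
congr (_ + _).
  apply: eq_big_nat => i /andP[_ si].
  congr (Normc.normc (f _ - f _)).
    by rewrite nth_rcons si; exact: set_nth_default.
  rewrite -rcons_cons nth_rcons/= ltnS (ltnW si).
  by apply: set_nth_default => /=; rewrite ltnS ltnW.
rewrite -rcons_cons !nth_rcons/= !ltnS ltnn eqxx leqnn.
congr (Normc.normc (f _ - f _)).
by rewrite -[LHS]/(nth c (a :: s) (size (a :: s)).-1) nth_last.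
Qed.

Lemma ctotal_variation_homo a b c f : a <= b -> b <= c ->
  (ctotal_variation a b f <= ctotal_variation a c f)%E.
Proof.
move=> ab; rewrite le_eqVlt => /predU1P[<-//|bc].
apply: ge_ereal_sup => _ [_ [s abs <-] <-].
apply: (@le_trans _ _ (cvariation a c f (rcons s c))%:E).
  rewrite (cvariation_rcons _ _ abs) lee_fin lerDl.
  by case: (_ - _) => x y; exact: sqrtr_ge0.
apply: ereal_sup_ubound => /=; exists (cvariation a c f (rcons s c)) => //.
exists (rcons s c) => //; case: abs => ps /eqP ls.
by split; rewrite ?last_rcons// rcons_path ps ls.
Qed.

Lemma ctotal_variation_fin a b f : a <= b -> cbounded_variation a b f ->
  ctotal_variation a b f \is a fin_num.
Proof.
move=> ab [x fx]; rewrite ge0_fin_numE ?ctotal_variation_ge0//.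
apply: le_lt_trans (ltry x).
by apply: ge_ereal_sup => _ [y fy <-]; rewrite lee_fin fx.
Qed.

Lemma tv_from_nd f M : {homo tv_from f M : x y / x <= y}.
Proof.
move=> x y xy; rewrite /tv_from.
case: asboolP => //= bv.
have finV z : M <= z -> ctotal_variation M z f \is a fin_num.
  rewrite le_eqVlt => /predU1P[<-|Mz]; last exact/ctotal_variation_fin/bv/Mz/ltW.
  apply: ctotal_variation_fin => //; exists 0 => _ [s /itv_partitionxx -> <-].
  by rewrite /cvariation big_nil.
case: ifPn => Mx; last first.
  by case: ifPn => // My; rewrite fine_ge0// ctotal_variation_ge0.
have My := le_trans Mx xy; rewrite My fine_le ?finV//.
exact: ctotal_variation_homo.
Qed.

Lemma tv_from_right_cvg f M t :
  tv_from f M s @[s --> t^'+] --> tv_from_right f M t.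
Proof.
apply: nondecreasing_at_right_is_cvgr.
  by apply: nearW => y u v _ _; exact: tv_from_nd.
near=> y; exists (tv_from f M t) => _ [u /= uy <-].
by move: uy; rewrite in_itv/= => /andP[tu _]; exact/tv_from_nd/ltW.
Unshelve. all: by end_near. Qed.

Lemma tv_from_right_le f M s t : s < t -> tv_from_right f M s <= tv_from f M t.
Proof.
move=> st; apply: limr_le; first exact: tv_from_right_cvg.
near=> u; apply/tv_from_nd/ltW.
by near: u; exact: nbhs_right_lt.
Unshelve. all: by end_near. Qed.

Lemma tv_from_right_ge f M t : tv_from f M t <= tv_from_right f M t.
Proof.
apply: limr_ge; first exact: tv_from_right_cvg.
by near=> u; apply/tv_from_nd.
Unshelve. all: by end_near. Qed.

Lemma tv_from_right_nd f M : {homo tv_from_right f M : x y / x <= y}.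
Proof.
move=> x y; rewrite le_eqVlt => /predU1P[->//|xy].
exact: le_trans (tv_from_right_le f M xy) (tv_from_right_ge f M y).
Qed.

Lemma tv_from_right_rc f M : right_continuous (tv_from_right f M).
Proof.
move=> t; apply/cvgrPdist_le => e e0.
have /cvgrPdist_le/(_ e e0) near_e := @tv_from_right_cvg f M t.
have [d /= d0 dP] := near_e.
near=> s.
have ts : t < s by near: s; exact: nbhs_right_gt.
have td : s < t + d by near: s; apply: nbhs_right_lt; rewrite ltrDl.
pose u := (s + (t + d)) / 2.
have su : s < u by rewrite midf_lt.
have ud : u < t + d by rewrite midf_lt.
have tu := lt_trans ts su.
have := dP u; rewrite /ball_/= => /(_ _ tu).
rewrite distrC gtr0_norm ?subr_gt0// ltrBlDl => /(_ ud).
rewrite distrC ger0_norm; last by rewrite subr_ge0 tv_from_right_le.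
rewrite distrC ger0_norm; last by rewrite subr_ge0 tv_from_right_nd// ltW.
by apply: le_trans; rewrite lerB// tv_from_right_le.
Unshelve. all: by end_near. Qed.

HB.instance Definition _ f M :=
  isCumulative.Build R _ R (tv_from_right f M)
    (@tv_from_right_nd f M) (@tv_from_right_rc f M).

Definition tv_integral f M (g : R -> R) : \bar R :=
  (\int[lebesgue_stieltjes_measure (tv_from_right f M)]_(t in `[M, +oo[)
    (g t)%:E)%E.

(* [I M = o(g M)] as [M] tends to infinity, for a possibly infinite [I M]; this
   is the library's [=o_], in the extended reals, so that [I M] is finite for
   [M] large enough. *)
Definition ereal_littleo (I : R -> \bar R) (g : R -> R) :=
  forall e, 0 < e -> \forall M \near +oo, (`|I M| <= (e * `|g M|)%:E)%E.

End complex_variation.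

Section transform.
Context {R : realType}.
Implicit Types (f : R -> R[i]) (alpha nu mu N r : R).

Definition vanishing_at_infinity f := (f t : R[i]^o) @[t --> +oo] --> (0 : R[i]^o).

(* [r ^ mu * (r * t) ^ nu] is read as [r ^ (mu + nu) * t ^ nu]. *)
Definition partial_transform alpha nu mu f N r : R[i]^o :=
  (r `^ (mu + nu))%:C *
  cintegral `]0, N[ (fun t => (t `^ nu)%:C * f t * (bessel_j alpha (r * t))%:C).

Definition transform alpha nu mu f r : R[i]^o :=
  lim (partial_transform alpha nu mu f N r @[N --> +oo]).

Definition transform_cvg_uniformly alpha nu mu f (E : set R) :=
  {uniform E, partial_transform alpha nu mu f N @[N --> +oo]
    --> transform alpha nu mu f}.

End transform.

(* Main.v *)
Require Import Defs.
From mathcomp Require Import all_boot all_order all_algebra.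
From mathcomp Require Import all_classical all_reals all_analysis.
From mathcomp Require Import complex measurable_realfun ring lra.
Import Order.TTheory GRing.Theory Num.Theory.
Import numFieldNormedType.Exports.
Local Open Scope classical_set_scope.
Local Open Scope ring_scope.
Local Open Scope complex_scope.

(* Put [beta = nu - alpha - 1/2]. By Bessel's equation, [w u = u^(alpha + 1/2) j(u)]
   satisfies [w'' = (c / u^2 - 1) w], so that [w] and [w'] are bounded on [[1, +oo[]
   (the energy [w^2 + w'^2] grows by a factor of at most [exp |c|]), and two
   integrations by parts bound the integral of [u^nu j(u) = u^beta w(u)] over [[a, b]],
   [1 <= a], by a multiple of [max (a^beta) (b^beta)]. The function [t^nu j(r t)] thus
   has on [[M, N]], for [r M >= 1], a primitive bounded by a multiple of
   [r^(beta - nu - 1) t^beta], and integrating by parts against [df] bounds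
   [r^(mu + nu)] times the integral of [t^nu f(t) j(r t)] over [[M, N]] by a multiple of
   [r^kappa (|f N| N^beta + |f M| M^beta + int_M^oo t^beta |df|)], where
   [kappa = mu + nu - alpha - 3/2 <= 0]. Each hypothesis on [|df|] gives, with [f -> 0],
   [int_M^oo t^beta |df| = o(M^kappa)] and [f M = o(M^(mu - 1))], so this is small
   uniformly in [r >= 1/M]. For [r < 1/M] the integral is cut at [1/r]; before [1/r],
   the boundedness of [j] on [[0, 1]] and [f t = o(t^(mu - 1))] suffice. *)

Set Implicit Arguments.
Unset Strict Implicit.
Unset Printing Implicit Defensive.

(** * Calculus *)

Section calculus.
Context {R : realType}.
Implicit Types (f df h dh : R -> R) (a b x p : R).

Local Notation leb := lebesgue_measure.

Lemma is_derive_continuous f (df x : R) : is_derive x 1 f df -> {for x, continuous f}.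
Proof.
by move=> [fx _]; apply: differentiable_continuous; exact/derivable1_diffP.
Qed.

Lemma for_within_continuous f (A : set R) :
  (forall x, A x -> {for x, continuous f}) -> {within A, continuous f}.
Proof.
by move=> cf; apply: continuous_in_subspaceT => x /set_mem; exact: cf.
Qed.

Lemma is_derive_le0 f df a b : a <= b ->
  (forall x, a <= x <= b -> is_derive x 1 f (df x)) ->
  (forall x, a <= x <= b -> df x <= 0) -> f b <= f a.
Proof.
move=> ab fdf df0.
apply: (@ler0_derive1_nincr _ f a b) => //.
- by move=> x /[!in_itv]/= /andP[/ltW ax /ltW xb]; have [] := fdf x _; rewrite ?ax.
- move=> x /[!in_itv]/= /andP[/ltW ax /ltW xb].
  have [|_ dfx] := fdf x _; first by rewrite ax.
  by rewrite derive1E dfx df0// ax.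
- apply: for_within_continuous => x /=; rewrite in_itv/= => xab.
  exact: is_derive_continuous (fdf x xab).
Qed.

(** Both [f - h] and [- f - h] have a nonpositive derivative. This replaces estimates of integrals
    by comparison with an explicit primitive [h]. *)
Lemma is_derive_norm_le f df h dh a b : a <= b ->
  (forall x, a <= x <= b -> is_derive x 1 f (df x)) ->
  (forall x, a <= x <= b -> is_derive x 1 h (dh x)) ->
  (forall x, a <= x <= b -> `|df x| <= dh x) ->
  `|f b - f a| <= h b - h a.
Proof.
move=> ab fdf hdh dfdh; rewrite ler_norml; apply/andP; split.
  have : (- f - h) b <= (- f - h) a.
    apply: (@is_derive_le0 _ (fun x => - df x - dh x)) => // x xab.
      have := fdf x xab; have := hdh x xab => ? ?.
      exact: is_deriveB.
    have := dfdh x xab; rewrite ler_norml; lra.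
  rewrite !fctE; lra.
have : (f - h) b <= (f - h) a.
  apply: (@is_derive_le0 _ (fun x => df x - dh x)) => // x xab.
    have := fdf x xab; have := hdh x xab => ? ?.
    exact: is_deriveB.
  have := dfdh x xab; rewrite ler_norml; lra.
rewrite !fctE; lra.
Qed.

Lemma continuous_itv_integrable f a b (x y : bool) :
  (forall t, a <= t <= b -> {for t, continuous f}) ->
  leb.-integrable [set` Interval (BSide x a) (BSide y b)] (EFin \o f).
Proof.
move=> cf.
have fab : leb.-integrable `[a, b] (EFin \o f).
  apply: continuous_compact_integrable; first exact: segment_compact.
  by apply: for_within_continuous => t /=; rewrite in_itv/=; exact: cf.
apply: (integrableS _ _ _ fab) => //.
by apply: subset_itv; rewrite bnd_simp.
Qed.

Lemma Rintegral_is_derive f df a b : a <= b ->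
  (forall x, a <= x <= b -> is_derive x 1 f (df x)) ->
  (forall x, a <= x <= b -> {for x, continuous df}) ->
  \int[leb]_(t in `[a, b]) df t = f b - f a.
Proof.
rewrite le_eqVlt => /predU1P[->|ab] fdf cdf.
  by rewrite set_itv1 Rintegral_set1 subrr.
rewrite /Rintegral (@continuous_FTC2 _ df f)//=.
- by apply: for_within_continuous => x /=; rewrite in_itv/=; exact: cdf.
- split.
  + by move=> x /[!in_itv]/= /andP[/ltW ax /ltW xb]; have [] := fdf x _; rewrite ?ax.
  + apply: cvg_at_right_filter; apply: (is_derive_continuous (fdf a _)).
    by rewrite lexx ltW.
  + apply: cvg_at_left_filter; apply: (is_derive_continuous (fdf b _)).
    by rewrite lexx ltW.
- move=> x /[!in_itv]/= /andP[/ltW ax /ltW xb].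
  have [|_ dfx] := fdf x _; first by rewrite ax.
  by rewrite derive1E dfx.
Qed.

Lemma powR_continuous_at p x : 0 < x -> {for x, continuous (fun t : R => t `^ p)}.
Proof. by move=> x0; exact: is_derive_continuous (is_derive1_powR p x0). Qed.

Lemma powR_le_max (p a b u : R) : 0 < a -> a <= u <= b ->
  u `^ p <= Num.max (a `^ p) (b `^ p).
Proof.
move=> a0 /andP[au ub]; have u0 := lt_le_trans a0 au; have b0 := lt_le_trans u0 ub.
rewrite le_max; have [p0|/ltW p0] := leP 0 p.
  by rewrite orbC ge0_ler_powR ?nnegrE ?(ltW u0) ?(ltW b0).
rewrite -(opprK p) !(powRN _ (- _)) lef_pV2 ?posrE ?powR_gt0//.
by rewrite ge0_ler_powR ?oppr_ge0 ?nnegrE ?(ltW u0) ?(ltW a0).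
Qed.

Lemma measurable_powR_EFin (p : R) (A : set (measurableTypeR R)) :
  measurable_fun A (fun t : measurableTypeR R => (t `^ p)%:E).
Proof. by apply/measurable_EFinP; exact: measurable_funS (measurable_powR p). Qed.

Lemma is_derive_cstf (c x : R) : is_derive x 1 (fun _ : R => c) 0.
Proof. exact: is_derive_cst. Qed.

(** * Differentiation rules with functions and derivatives written pointwise *)

Section pointwise_rules.
Variables (f g : R -> R) (df dg x : R).
Hypotheses (fx : is_derive x 1 f df) (gx : is_derive x 1 g dg).

Lemma is_derive_addf : is_derive x 1 (fun t => f t + g t) (df + dg).
Proof. exact: is_deriveD. Qed.

Lemma is_derive_oppf : is_derive x 1 (fun t => - f t) (- df).
Proof. exact: is_deriveN. Qed.

Lemma is_derive_mulf :
  is_derive x 1 (fun t => f t * g t) (df * g x + f x * dg).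
Proof. by apply: (is_derive_eq (is_deriveM fx gx)); rewrite addrC /GRing.scale/= mulrC. Qed.

Lemma is_derive_mullf (k : R) : is_derive x 1 (fun t => k * f t) (k * df).
Proof. exact: (is_deriveZ k). Qed.

Lemma is_derive_invf : f x != 0 ->
  is_derive x 1 (fun t => (f t)^-1) (- df / f x ^+ 2).
Proof.
move=> fx0; apply: (is_derive_eq (is_deriveV fx0 fx)).
by rewrite /GRing.scale/= mulNr mulrC -mulNr.
Qed.

Lemma is_derive_compf (h : R -> R) (dh : R) : is_derive (f x) 1 h dh ->
  is_derive x 1 (fun t => h (f t)) (dh * df).
Proof. by move=> hfx; exact: is_derive1_comp. Qed.

End pointwise_rules.

End calculus.

(** * Bessel functions *)

Section power_series.
Context {R : realType}.
Implicit Types (c : R^nat) (y alpha : R) (k n : nat).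

(** Comparison with the exponential series. The bound by inverse factorials is preserved by formal
    differentiation, so one criterion serves a series and all its derivatives. *)
Lemma is_cvg_pseries_inv_fact c y : (forall k, `|c k| <= k`!%:R^-1) ->
  cvgn (pseries c y).
Proof.
move=> cb; apply: normed_cvg.
apply: (@series_le_cvg _ _ (exp_coeff `|y|)) => [n|n|n|].
- by rewrite normr_ge0.
- by rewrite /exp_coeff/= divr_ge0.
- by rewrite /exp_coeff/= normrM normrX mulrC ler_wpM2l.
- exact: is_cvg_series_exp_coeff.
Qed.

Lemma pseries_diffs_inv_fact_le c : (forall k, `|c k| <= k`!%:R^-1) ->
  forall k, `|pseries_diffs c k| <= k`!%:R^-1.
Proof.
move=> cb k; rewrite /pseries_diffs normrM ger0_norm//.
rewrite (le_trans (ler_wpM2l _ (cb k.+1)))//.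
by rewrite factS natrM invfM mulrA divff ?mul1r.
Qed.

Lemma is_derive_pseries_inv_fact c y : (forall k, `|c k| <= k`!%:R^-1) ->
  is_derive y 1 (fun x => limn (pseries c x)) (limn (pseries (pseries_diffs c) y)).
Proof.
move=> cb; apply: (@pseries_snd_diffs _ c (`|y| + 1) y).
- exact: is_cvg_pseries_inv_fact.
- exact/is_cvg_pseries_inv_fact/pseries_diffs_inv_fact_le.
- by apply: is_cvg_pseries_inv_fact; do 2 apply: pseries_diffs_inv_fact_le.
- by rewrite [ltRHS]ger0_norm ?addr_ge0// ltrDl.
Qed.

(** The rising factorial of [alpha + 1], that is [Gamma (k + alpha + 1) / Gamma (alpha + 1)]; it
    frees the coefficients of the series from [Gamma]. *)
Definition pochhammer1 alpha k : R := \prod_(0 <= i < k) (i%:R + alpha + 1).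

Definition bessel_phi_coef alpha k : R :=
  (-1) ^+ k / (k`!%:R * (4 ^+ k * pochhammer1 alpha k)).

(* [bessel_j alpha z = bessel_phi alpha (z ^+ 2)] for [0 <= z] *)
Definition bessel_phi alpha y : R := limn (pseries (bessel_phi_coef alpha) y).

Definition bessel_phi' alpha y : R :=
  limn (pseries (pseries_diffs (bessel_phi_coef alpha)) y).

Definition bessel_phi'' alpha y : R :=
  limn (pseries (pseries_diffs (pseries_diffs (bessel_phi_coef alpha))) y).

(** Passing from [k] to [k.+1] multiplies by [4 * (k + alpha + 1)], which is at least 2. *)
Lemma pochhammer1_ge1 alpha k : - (1 / 2) <= alpha ->
  1 <= 4 ^+ k * pochhammer1 alpha k.
Proof.
move=> ha; elim: k => [|k IH]; first by rewrite /pochhammer1 big_nil expr0 mulr1.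
have k0 : 0 <= k%:R :> R by [].
rewrite /pochhammer1 big_nat_recr//= exprS.
rewrite (_ : _ * _ = 4 ^+ k * pochhammer1 alpha k * (4 * (k%:R + alpha + 1))).
  by rewrite mulr_ege1//; lra.
by rewrite /pochhammer1; ring.
Qed.

Lemma bessel_phi_coef_le alpha k : - (1 / 2) <= alpha ->
  `|bessel_phi_coef alpha k| <= k`!%:R^-1.
Proof.
move=> ha; rewrite /bessel_phi_coef normrM normrX normrN1 expr1n mul1r.
have := pochhammer1_ge1 k ha; set P := _ * _ => P1.
have P0 : 0 < P := lt_le_trans ltr01 P1.
have k0 : 0 < k`!%:R :> R by rewrite ltr0n fact_gt0.
rewrite normfV ger0_norm; last by rewrite mulr_ge0 // ltW.
by rewrite invfM ler_piMr ?invr_ge0// invf_le1.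
Qed.

(** The coefficient of [y ^+ k] in the differential equation [bessel_phi_ode]. *)
Lemma bessel_phi_coefS alpha k : - (1 / 2) <= alpha ->
  (k%:R + alpha + 1) * (k.+1%:R * bessel_phi_coef alpha k.+1)
    + bessel_phi_coef alpha k / 4 = 0.
Proof.
move=> ha; rewrite /bessel_phi_coef /pochhammer1 big_nat_recr//= exprS exprS factS natrM.
have := pochhammer1_ge1 k ha; rewrite /pochhammer1; set P := \prod_(_ <= _ < _) _ => P1.
have k0 : k`!%:R != 0 :> R by rewrite pnatr_eq0 -lt0n fact_gt0.
have kk0 : 0 <= k%:R :> R by [].
have P0 : P != 0.
  by apply/eqP => P0; move: P1; rewrite P0 mulr0 ler10.
have a0 : k%:R + alpha + 1 != 0 by rewrite gt_eqF//; lra.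
have f0 : 4 ^+ k != 0 :> R by rewrite expf_eq0 pnatr_eq0 andbF.
field.
by rewrite P0 f0 k0 a0 /= gt_eqF//; lra.
Qed.

(** Bessel's equation for [j(z)] in the variable [y = z ^+ 2]. *)
Lemma bessel_phi_ode alpha y : - (1 / 2) <= alpha ->
  y * bessel_phi'' alpha y + (alpha + 1) * bessel_phi' alpha y
    + bessel_phi alpha y / 4 = 0.
Proof.
move=> ha; set c := bessel_phi_coef alpha.
have cb k : `|c k| <= k`!%:R^-1 := bessel_phi_coef_le k ha.
have c0 := is_cvg_pseries_inv_fact (y := y) cb.
have c1 := is_cvg_pseries_inv_fact (y := y) (pseries_diffs_inv_fact_le cb).
have c2 := is_cvg_pseries_inv_fact (y := y)
  (pseries_diffs_inv_fact_le (pseries_diffs_inv_fact_le cb)).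
(* The factor [y] raises the degree by one, so the other two sums are taken one term further: all
   three then stop at degree [n], and [s n] vanishes exactly, not only in the limit. *)
pose s n := y * pseries (pseries_diffs (pseries_diffs c)) y n
  + (alpha + 1) * pseries (pseries_diffs c) y n.+1 + pseries c y n.+1 / 4.
have s0 n : s n = 0.
  elim: n => [|n IH].
    rewrite /s /pseries /series/= !big_nat1 big_nil /pseries_diffs.
    have := bessel_phi_coefS 0 ha; rewrite -/c !expr0; lra.
  have E := bessel_phi_coefS n.+1 ha; rewrite -/c in E.
  rewrite -[RHS]IH /s /pseries seriesSr [in X in _ + X + _](seriesSr _ n.+1).
  rewrite [in X in _ + _ + X](seriesSr _ n.+1) /= -[RHS]addr0.
  rewrite -[in X in _ = _ + X](mul0r (y ^+ n.+1)) -E /pseries_diffs exprS.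
  rewrite -[n.+2%:R]natr1; ring.
have : s n @[n --> \oo] --> y * bessel_phi'' alpha y
    + (alpha + 1) * bessel_phi' alpha y + bessel_phi alpha y / 4.
  apply: cvgD; first apply: cvgD.
  - by apply: cvgMr; exact: c2.
  - by apply: cvgMr; rewrite (cvg_shiftS (pseries _ y)); exact: c1.
  - by apply: cvgMl; rewrite (cvg_shiftS (pseries _ y)); exact: c0.
rewrite (_ : s = fun=> 0); last exact/funext.
by move=> /(cvg_unique (@Rhausdorff R)); apply; exact: cvg_cst.
Qed.

Lemma is_derive_bessel_phi alpha y : - (1 / 2) <= alpha ->
  is_derive y 1 (bessel_phi alpha) (bessel_phi' alpha y).
Proof. by move=> ha; apply: is_derive_pseries_inv_fact => k; exact: bessel_phi_coef_le. Qed.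

Lemma is_derive_bessel_phi' alpha y : - (1 / 2) <= alpha ->
  is_derive y 1 (bessel_phi' alpha) (bessel_phi'' alpha y).
Proof.
move=> ha; apply: is_derive_pseries_inv_fact; apply: pseries_diffs_inv_fact_le => k.
exact: bessel_phi_coef_le.
Qed.

End power_series.

(** * Finiteness, functional equation and positivity of the Gamma function *)

Section gamma_function.
Context {R : realType}.
Implicit Types (x t a b : R) (n : nat).

Local Notation leb := lebesgue_measure.

Let gint x t : R := t `^ (x - 1) * expR (- t).

(** Truncation to a compact interval away from 0, where the integrand is continuous and the
    fundamental theorem of calculus applies. *)
Let gpart x n : R := \int[leb]_(t in `[n.+1%:R^-1, n.+1%:R]) gint x t.

(** For [t <= 1] the power is at most 1; for [t > 1] it is at most [t ^+ m.+1], which a single term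
    of the exponential series dominates. *)
Lemma powR_expRN_bounded x : 0 <= x -> exists2 C : R, 0 <= C &
  forall t, 0 < t -> t `^ x * expR (- t) <= C.
Proof.
move=> x0; pose m := `|Num.ceil x|%N.
exists (m.+1`!%:R) => // t t0.
rewrite expRN ler_pdivrMr ?expR_gt0//.
have fe : m.+1`!%:R * (1 + t ^+ m.+1 / m.+1`!%:R) <= m.+1`!%:R * expR t.
  by rewrite ler_wpM2l// expR_ge1Dxn// ltW.
apply: le_trans fe; have f0 : 0 < m.+1`!%:R :> R by rewrite ltr0n fact_gt0.
rewrite mulrDr mulr1 mulrCA divff ?gt_eqF// mulr1.
have [t1|t1] := leP t 1.
  rewrite -[leLHS]addr0 lerD// ?exprn_ge0 ?(ltW t0)//.
  apply: (@le_trans _ _ 1); last by rewrite ler1n fact_gt0.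
  have /(_ _ _ t1) := @ge0_ler_powR _ x x0 t 1; rewrite powR1.
  by apply; rewrite nnegrE// ltW.
rewrite -[leLHS]add0r lerD// -powR_mulrn ?(ltW t0)//.
apply: ler_powR; first exact: ltW t1.
rewrite (le_trans (ceil_ge _))// -natr1.
rewrite (_ : (Num.ceil x)%:~R = m%:R :> R) ?lerDl//.
by rewrite /m natr_absz ger0_norm// ceil_ge0 ?(lt_le_trans _ x0)// ltrN10.
Qed.

Let gint_continuous x t : 0 < t -> {for t, continuous (gint x)}.
Proof.
move=> t0; apply: cvgM; first exact: powR_continuous_at.
apply: (continuous_comp (f := -%R)); first exact: oppr_continuous.
exact: continuous_expR.
Qed.

Let gint_ge0 x t : 0 <= gint x t.
Proof. by rewrite mulr_ge0 ?powR_ge0 ?expR_ge0. Qed.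

Let invn_gt0 n : 0 < n.+1%:R^-1 :> R. Proof. by rewrite invr_gt0. Qed.

Let invn_le n : n.+1%:R^-1 <= n.+1%:R :> R.
Proof. by rewrite (@le_trans _ _ 1)// ?invf_le1// ler1n. Qed.

Let gpart_cvgE x :
  (gpart x n)%:E @[n --> \oo] --> (\int[leb]_(t in `]0%R, +oo[) (gint x t)%:E)%E.
Proof.
pose F n := `[n.+1%:R^-1, n.+1%:R : R]%classic.
have -> : `]0%R, +oo[%classic = \bigcup_n F n.
  apply/seteqP; split=> t /=; rewrite in_itv/= ?andbT.
    move=> t0; exists (Num.truncn (t + t^-1)) => //=.
    have tt : t + t^-1 < (Num.truncn (t + t^-1)).+1%:R by rewrite truncnS_gt.
    have ti : 0 < t^-1 by rewrite invr_gt0.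
    rewrite /F/= in_itv/=; apply/andP; split; last lra.
    rewrite -[leRHS]invrK lef_pV2 ?posrE//; lra.
  by move=> [n _]; rewrite /F/= in_itv/= => /andP[+ _]; exact: lt_le_trans.
have FE n : (gpart x n)%:E = (\int[leb]_(t in F n) (gint x t)%:E)%E.
  rewrite /gpart /Rintegral fineK//; apply: integrable_fin_num => //.
  apply: continuous_itv_integrable => t /andP[nt _].
  exact/gint_continuous/lt_le_trans/nt.
under eq_fun do rewrite FE.
apply: ge0_nondecreasing_set_cvg_integral => //.
- move=> m n mn; apply/subsetPset; apply: subset_itv; rewrite bnd_simp.
    by rewrite lef_pV2 ?posrE// ler_nat ltnS.
  by rewrite ler_nat ltnS.
- by move=> n; exact: measurable_itv.
- move=> n; apply: (@measurable_int _ _ _ leb).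
  apply: continuous_itv_integrable => t /andP[nt _].
  exact/gint_continuous/lt_le_trans/nt.
- by move=> n t _; rewrite lee_fin.
Qed.

(** The integrand is dominated by [h], the derivative of the bounded function [- D / (1 + t^x)].
    This one majorant handles both the singularity at 0 and the tail at infinity. *)
Let gpart_bounded x : 0 < x -> exists C, forall n, gpart x n <= C.
Proof.
move=> x0; have x20 : 0 <= 2 * x by rewrite mulr_ge0// ltW.
have [C C0 tC] := powR_expRN_bounded x20.
exists ((2 + 2 * C) / x) => n.
set D := (2 + 2 * C) / x.
have D0 : 0 <= D by rewrite divr_ge0 ?(ltW x0)// addr_ge0// mulr_ge0.
pose h t : R := x * t `^ (x - 1) * ((1 + t `^ x) ^- 2) * D.
have den t : 0 < 1 + t `^ x by rewrite ltr_pwDl// powR_ge0.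
have hd t : 0 < t -> is_derive t 1 (fun t => - (1 + t `^ x)^-1 * D) (h t).
  move=> t0; have dt := is_derive1_powR x t0.
  have d1 : is_derive t 1 (fun t => 1 + t `^ x) (x * t `^ (x - 1)).
    by have := is_derive_addf (is_derive_cstf 1 t) dt; rewrite add0r.
  have d2 := is_derive_mullf (is_derive_invf d1 (lt0r_neq0 (den t))) (- D).
  rewrite (_ : (fun _ => _) = (fun t => - D * (1 + t `^ x)^-1)).
    by apply: (is_derive_eq d2); rewrite /h; ring.
  by apply/funext => s; ring.
have hc t : 0 < t -> {for t, continuous h}.
  move=> t0; apply: cvgMl; apply: cvgM.
    by apply: cvgMr; exact: powR_continuous_at.
  apply: cvgV; first by rewrite expf_neq0// lt0r_neq0.
  have c1 : {for t, continuous (fun t => 1 + t `^ x)}.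
    by apply: cvgD; [exact: cvg_cst|exact: powR_continuous_at].
  by rewrite (_ : (fun t => _ ^+ 2) = (fun t => (1 + t `^ x) * (1 + t `^ x)));
    [exact: cvgM|apply/funext => s; rewrite expr2].
have pos t : n.+1%:R^-1 <= t <= n.+1%:R -> 0 < t.
  by move=> /andP[nt _]; exact: lt_le_trans nt.
rewrite (@le_trans _ _ (\int[leb]_(t in `[n.+1%:R^-1, n.+1%:R]) h t))//.
  apply: le_Rintegral => //=.
  - by apply: continuous_itv_integrable => t /pos; exact: gint_continuous.
  - by apply: continuous_itv_integrable => t /pos; exact: hc.
  - move=> t; rewrite in_itv/= => /pos t0.
    rewrite /gint /h /D.
    have p0 : 0 <= t `^ (x - 1) := powR_ge0 _ _.
    rewrite (_ : _ * _ * _ * _ = t `^ (x - 1) *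
        ((2 + 2 * C) / (1 + t `^ x) ^+ 2)); last first.
      by field; rewrite (gt_eqF x0) gt_eqF.
    rewrite ler_wpM2l// ler_pdivlMr ?exprn_gt0//.
    have e0 := expR_ge0 (- t).
    have e1 : expR (- t) <= 1 by rewrite expR_le1 oppr_le0 ltW.
    have := tC t t0; rewrite (mulrC 2 x) powRrM powR_mulrn ?powR_ge0// .
    set y := t `^ x; set e := expR _ in e0 e1 * => yC.
    (* This is [(1 + y)^2 <= 2 + 2 y^2] multiplied by [e]; then [e <= 1] and [y^2 e <= C] give the
       constant [2 + 2 C] of [D]. *)
    have : 0 <= e * (1 - y) ^+ 2 by rewrite mulr_ge0// sqr_ge0.
    nra.
have := Rintegral_is_derive (invn_le n) (fun t tn => hd t (pos t tn))
  (fun t tn => hc t (pos t tn)).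
move=> ->; rewrite -mulrBl ler_piMl// opprK addrC.
have d1 : 0 <= (1 + n.+1%:R `^ x)^-1 by rewrite invr_ge0 ltW.
have d2 : (1 + n.+1%:R^-1 `^ x)^-1 <= 1 by rewrite invf_le1// lerDl powR_ge0.
lra.
Qed.

(** Finiteness excludes the default value 0 that [Rintegral] would give to [Gamma x]. *)
Let gint_fin x : 0 < x ->
  (\int[leb]_(t in `]0%R, +oo[) (gint x t)%:E)%E \is a fin_num.
Proof.
move=> x0; have [C Cx] := gpart_bounded x0.
rewrite ge0_fin_numE; last by apply: integral_ge0 => t _; rewrite lee_fin.
apply: le_lt_trans (ltry C).
rewrite -(cvg_lim (@ereal_hausdorff R) (gpart_cvgE (x := x))).
apply: lime_le; first by apply/cvg_ex; eexists; exact: gpart_cvgE.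
by near=> n; rewrite lee_fin.
Unshelve. all: by end_near. Qed.

Let gpart_cvg x : 0 < x -> gpart x n @[n --> \oo] --> Gamma x.
Proof.
move=> x0; have := gpart_cvgE (x := x).
rewrite -(fineK (gint_fin x0)); exact: fine_cvg.
Qed.

(** Integration by parts: the combined integrand is the derivative of [t^x * expR (- t)]. *)
Let gpartS x n : 0 < x -> x * gpart x n - gpart (x + 1) n =
  n.+1%:R `^ x * expR (- n.+1%:R) - n.+1%:R^-1 `^ x * expR (- n.+1%:R^-1).
Proof.
move=> x0; have pos t : n.+1%:R^-1 <= t <= n.+1%:R -> 0 < t.
  by move=> /andP[nt _]; exact: lt_le_trans nt.
have hc t : n.+1%:R^-1 <= t <= n.+1%:R ->
    {for t, continuous (fun t => x * gint x t - gint (x + 1) t)}.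
  move=> /pos t0; apply: cvgB; last exact: gint_continuous.
  by apply: cvgMr; exact: gint_continuous.
have hd t : n.+1%:R^-1 <= t <= n.+1%:R ->
    is_derive t 1 (fun t => t `^ x * expR (- t)) (x * gint x t - gint (x + 1) t).
  move=> /pos t0; have dt := is_derive1_powR x t0.
  have dN := is_derive_oppf (is_derive_id t (1 : R)).
  have dE := is_derive_compf dN (is_derive_expR (- t)).
  by apply: (is_derive_eq (is_derive_mulf dt dE)); rewrite /gint addrK; ring.
rewrite -(Rintegral_is_derive (invn_le n) hd hc) RintegralB//; first last.
- by apply: continuous_itv_integrable => t /pos; exact: gint_continuous.
- apply: continuous_itv_integrable => t /pos t0.
  by apply: cvgMr; exact: gint_continuous.
rewrite RintegralZl//.
by apply: continuous_itv_integrable => t /pos; exact: gint_continuous.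
Qed.

Lemma GammaS x : 0 < x -> Gamma (x + 1) = x * Gamma x.
Proof.
move=> x0; have xS : 0 < x + 1 by rewrite addr_gt0.
apply/esym/eqP; rewrite -subr_eq0; apply/eqP.
have lim1 : x * gpart x n - gpart (x + 1) n @[n --> \oo] -->
    x * Gamma x - Gamma (x + 1).
  by apply: cvgB; [apply: cvgMr|]; exact: gpart_cvg.
apply: (cvg_unique (@Rhausdorff R) lim1).
have -> : (fun n => x * gpart x n - gpart (x + 1) n) = (fun n =>
    n.+1%:R `^ x * expR (- n.+1%:R) - n.+1%:R^-1 `^ x * expR (- n.+1%:R^-1)).
  by apply/funext => n; exact: gpartS.
rewrite -(subr0 (0 : R)); apply: cvgB.
(* The bound is taken for the exponent [x + 1], which leaves a factor [1 / n.+1] to make the upper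
   boundary term vanish. *)
- have [C C0 tC] := powR_expRN_bounded (ltW xS).
  apply: (@squeeze_cvgr _ _ _ _ (fun=> 0) (fun n => C * n.+1%:R^-1)).
  + near=> n; rewrite mulr_ge0 ?powR_ge0 ?expR_ge0//= ler_pdivlMr//.
    apply: le_trans (tC n.+1%:R _) => //.
    by rewrite powRD ?pnatr_eq0 ?implybT// powRr1// mulrAC.
  + exact: cvg_cst.
  + by rewrite -(mulr0 C); apply: cvgMr; exact: cvg_harmonic.
- apply: (@squeeze_cvgr _ _ _ _ (fun=> 0) (fun n => n.+1%:R^-1 `^ x)).
  + near=> n; rewrite mulr_ge0 ?powR_ge0 ?expR_ge0//=.
    by rewrite ler_piMr ?powR_ge0// expR_le1 oppr_le0.
  + exact: cvg_cst.
  + apply: (cvg_comp (fun n => n.+1%:R^-1) (fun t => t `^ x)) (powR_cvg0 x0).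
    move=> A [e e0 eA]; have /cvgrPdist_lt/(_ e e0) := @cvg_harmonic R.
    by apply: filterS => n /= ne; apply: eA => //=.
Unshelve. all: by end_near. Qed.

(** On [[1/2, 2]] the integrand is at least the positive constant [m], for either sign of
    [x - 1]. *)
Lemma Gamma_gt0 x : 0 < x -> 0 < Gamma x.
Proof.
move=> x0.
pose m : R := Num.min (2^-1 `^ (x - 1)) (2 `^ (x - 1)) * expR (- 2).
have m0 : 0 < m by rewrite mulr_gt0 ?expR_gt0// lt_min !powR_gt0.
apply: (@lt_le_trans _ _ (m * (2 - 2^-1))).
  by rewrite mulr_gt0//; lra.
have mg t : 2^-1 <= t <= 2 -> m <= gint x t.
  move=> /andP[t1 t2]; have t0 : 0 < t by rewrite (lt_le_trans _ t1).
  apply: ler_pM; rewrite ?expR_ge0 ?ler_expR ?lerN2//.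
  rewrite ge_min; have [x1|/ltW x1] := leP 0 (x - 1).
    by rewrite ge0_ler_powR ?nnegrE// ltW.
  apply/orP; right.
  rewrite -(opprK (x - 1)) !(powRN _ (- _)) lef_pV2 ?posrE ?powR_gt0//.
  by rewrite ge0_ler_powR ?oppr_ge0 ?nnegrE// ltW.
have hab : (2^-1 : R) <= 2 by lra.
have pos t : 2^-1 <= t <= 2 -> 0 < t by move=> /andP[+ _]; exact: lt_le_trans.
rewrite -lee_fin /Gamma /Rintegral fineK; last exact: gint_fin.
apply: (@le_trans _ _ (\int[leb]_(t in `[(2^-1)%R, 2%R]) (gint x t)%:E)%E).
  apply: (@le_trans _ _ (\int[leb]_(t in `[(2^-1)%R, 2%R]) m%:E)%E).
    by rewrite integral_cst//= lebesgue_measure_itv/= lte_fin ifT -?EFinB ?EFinM//; lra.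
  apply: ge0_le_integral => //.
  - by move=> t _; rewrite lee_fin ltW.
  - apply: (@measurable_int _ _ _ leb).
    by apply: continuous_itv_integrable => t /pos; exact: gint_continuous.
have mgint : measurable_fun `](0 : R), +oo[ (gint x).
  apply: open_continuous_measurable_fun => // t.
  by rewrite inE/= in_itv/= andbT; exact: gint_continuous.
apply: ge0_subset_integral => //.
- exact/measurable_EFinP.
- by move=> t _; rewrite lee_fin.
- by move=> t /=; rewrite !in_itv/= andbT; exact: pos.
Qed.

End gamma_function.

(** * Boundedness and oscillation of the Bessel function *)

Section bessel_function.
Context {R : realType}.
Variable alpha : R.
Hypothesis alpha_ge : - (1 / 2) <= alpha.
Implicit Types (z u : R) (k n : nat).

Let a1_gt0 : 0 < alpha + 1. Proof. by move: alpha_ge; lra. Qed.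

Lemma Gamma_pochhammer1 k :
  Gamma (k%:R + alpha + 1) = pochhammer1 alpha k * Gamma (alpha + 1).
Proof.
elim: k => [|k IH]; first by rewrite /pochhammer1 big_nil add0r mul1r.
have k0 : 0 <= k%:R :> R by [].
rewrite (_ : k.+1%:R + alpha + 1 = k%:R + alpha + 1 + 1); last first.
  by rewrite -natr1; ring.
rewrite (@GammaS _ (k%:R + alpha + 1)); last by move: a1_gt0; lra.
by rewrite IH /pochhammer1 big_nat_recr//= mulrA (mulrC (_ + _ + 1)).
Qed.

Lemma bessel_phi0 : bessel_phi alpha 0 = 1.
Proof.
apply: cvg_lim => //; rewrite -cvg_shiftS.
rewrite (_ : (fun n => _) = fun=> 1); first exact: cvg_cst.
apply/funext => n; rewrite /pseries /series/= big_nat_recl//= big1 ?addr0.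
  by rewrite /bessel_phi_coef /pochhammer1 big_nil !expr0 !mulr1 divr1.
by move=> i _; rewrite exprS mul0r mulr0.
Qed.

(** Each term of [besselJ] contains [(z / 2)^alpha / Gamma (alpha + 1)], which the normalization
    cancels. The resulting power series in [z ^+ 2] also covers the separate value at 0. *)
Lemma bessel_jE z : 0 <= z -> bessel_j alpha z = bessel_phi alpha (z ^+ 2).
Proof.
rewrite le_eqVlt /bessel_j => /predU1P[<-|z0].
  by rewrite eqxx expr0n bessel_phi0.
have z2 : 0 < z / 2 by rewrite divr_gt0.
have G0 := Gamma_gt0 a1_gt0.
have p0 : 0 < (z / 2) `^ alpha by rewrite powR_gt0.
rewrite gt_eqF//; set c := bessel_phi_coef alpha.
have cvg_c : cvgn (pseries c (z ^+ 2)).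
  by apply: is_cvg_pseries_inv_fact => k; exact: bessel_phi_coef_le.
have -> : besselJ alpha z = (z / 2) `^ alpha / Gamma (alpha + 1) *
    limn (pseries c (z ^+ 2)).
  rewrite /besselJ; apply: cvg_lim => //.
  rewrite (_ : series _ = fun n => (z / 2) `^ alpha / Gamma (alpha + 1) *
      pseries c (z ^+ 2) n); first exact: cvgMr.
  apply/funext => n; rewrite /pseries /series/= mulr_sumr; apply: eq_bigr => k _.
  rewrite /besselJ_coef /c /bessel_phi_coef Gamma_pochhammer1.
  rewrite powRD; last by rewrite (gt_eqF z2) implybT.
  rewrite -natrM powR_mulrn ?(ltW z2)// exprM.
  have := pochhammer1_ge1 k alpha_ge; set P := pochhammer1 _ _ => P1.
  have P0 : P != 0 by apply/eqP => P0; move: P1; rewrite P0 mulr0 ler10.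
  have k0 : k`!%:R != 0 :> R by rewrite pnatr_eq0 -lt0n fact_gt0.
  rewrite (_ : (z / 2) ^+ 2 = z ^+ 2 / 4); last by field.
  rewrite expr_div_n; field.
  by rewrite (gt_eqF G0) P0 k0 expf_neq0.
rewrite powRN /bessel_phi mulrA [X in X * _](_ : _ = 1) ?mul1r//.
by field; rewrite (gt_eqF G0) gt_eqF.
Qed.

Lemma bessel_phi_sqr_continuous : continuous (fun z => bessel_phi alpha (z ^+ 2)).
Proof.
move=> z.
have d2 : is_derive z 1 (fun t : R => t * t) (1 * z + z * 1).
  exact: is_derive_mulf (is_derive_id z (1 : R)) (is_derive_id z (1 : R)).
have := is_derive_continuous (is_derive_compf d2 (is_derive_bessel_phi (z * z) alpha_ge)).
by rewrite (_ : (fun t => bessel_phi alpha (t * t)) = (fun t => bessel_phi alpha (t ^+ 2))).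
Qed.

Lemma bessel_phi_bounded : exists2 C : R, 0 <= C &
  forall z, 0 <= z <= 1 -> `|bessel_phi alpha (z ^+ 2)| <= C.
Proof.
have cf : {within `[(0 : R), 1], continuous (fun z => `|bessel_phi alpha (z ^+ 2)|)}.
  apply: for_within_continuous => z _; apply: cvg_norm.
  exact: bessel_phi_sqr_continuous.
have [c _ cmax] := EVT_max ler01 cf.
by exists `|bessel_phi alpha (c ^+ 2)|.
Qed.

Let w u : R := u `^ (alpha + 1 / 2) * bessel_phi alpha (u ^+ 2).
Let w' u : R := (alpha + 1 / 2) * u `^ (alpha - 1 / 2) * bessel_phi alpha (u ^+ 2)
  + 2 * (u `^ (alpha + 3 / 2) * bessel_phi' alpha (u ^+ 2)).
Let c : R := alpha ^+ 2 - 1 / 4.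

Let powRS u (p : R) : 0 < u -> u `^ (p + 1) = u `^ p * u.
Proof. by move=> u0; rewrite powRD ?(gt_eqF u0) ?implybT// powRr1 ?(ltW u0). Qed.

Let is_derive_w u : 0 < u -> is_derive u 1 w (w' u).
Proof.
move=> u0; have dp := is_derive1_powR (alpha + 1 / 2) u0.
have d2 : is_derive u 1 (fun t : R => t ^+ 2) (2 * u).
  apply: is_derive_eq; rewrite /GRing.scale/=; ring.
have dphi := is_derive_compf d2 (is_derive_bessel_phi (u ^+ 2) alpha_ge).
apply: (is_derive_eq (is_derive_mulf dp dphi)); rewrite /w'.
have -> : u `^ (alpha + 3 / 2) = u `^ (alpha + 1 / 2) * u.
  by rewrite -powRS//; congr (_ `^ _); field.
have -> : alpha + 1 / 2 - 1 = alpha - 1 / 2 by field.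
ring.
Qed.

(* The substitution [w u = u^(alpha + 1/2) j(u)] removes the first-order term of
   Bessel's equation. *)
Let is_derive_w' u : 0 < u -> is_derive u 1 w' ((c / u ^+ 2 - 1) * w u).
Proof.
move=> u0; have dp := is_derive1_powR (alpha - 1 / 2) u0.
have dq := is_derive1_powR (alpha + 3 / 2) u0.
have d2 : is_derive u 1 (fun t : R => t ^+ 2) (2 * u).
  apply: is_derive_eq; rewrite /GRing.scale/=; ring.
have dphi := is_derive_compf d2 (is_derive_bessel_phi (u ^+ 2) alpha_ge).
have dphi' := is_derive_compf d2 (is_derive_bessel_phi' (u ^+ 2) alpha_ge).
have := is_derive_addf (is_derive_mulf (is_derive_mullf dp (alpha + 1 / 2)) dphi)
  (is_derive_mullf (is_derive_mulf dq dphi') 2) => d.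
apply: (is_derive_eq d) => {d dphi dphi' d2 dp dq}.
(* All real powers of [u] are written as [q] times natural powers; once the differential equation
   eliminates [p0], the claim is a rational identity. *)
set q := u `^ (alpha - 1 / 2 - 1).
have q1 : u `^ (alpha - 1 / 2) = q * u.
  by rewrite -powRS//; congr (_ `^ _); ring.
have q2 : u `^ (alpha + 1 / 2) = q * u * u.
  by rewrite -!powRS//; congr (_ `^ _); field.
have q3 : u `^ (alpha + 3 / 2) = q * u * u * u.
  by rewrite -!powRS//; congr (_ `^ _); field.
have q4 : u `^ (alpha + 3 / 2 - 1) = q * u * u.
  by rewrite -!powRS//; congr (_ `^ _); field.
rewrite /w q1 q2 q3 q4.
have := bessel_phi_ode (u ^+ 2) alpha_ge.
move: (bessel_phi _ _) (bessel_phi' _ _) (bessel_phi'' _ _) => p0 p1 p2 ode.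
have -> : p0 = - 4 * (u ^+ 2 * p2 + (alpha + 1) * p1) by lra.
by rewrite /c; field; rewrite gt_eqF.
Qed.

(** The energy [w^2 + w'^2] has derivative [2 c w w' / u^2], at most [|c| / u^2] times the energy.
    The weight [expR (|c| / u)] compensates this growth, so [E] is nonincreasing; as the weight is
    at least 1, [E 1] bounds the energy. *)
Lemma bessel_w_bounded : exists2 B : R, 0 <= B &
  forall u, 1 <= u -> `|w u| <= B /\ `|w' u| <= B.
Proof.
pose E u := (w u ^+ 2 + w' u ^+ 2) * expR (`|c| / u).
have dE u : 0 < u -> is_derive u 1 E
    ((2 * w u * w' u * c / u ^+ 2 - (w u ^+ 2 + w' u ^+ 2) * `|c| / u ^+ 2) * expR (`|c| / u)).
  move=> u0.
  have dw := is_derive_w u0; have dw' := is_derive_w' u0.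
  have di := is_derive_mullf (is_derive_invf (is_derive_id u (1 : R)) (lt0r_neq0 u0)) `|c|.
  have de := is_derive_compf di (is_derive_expR (`|c| / u)).
  have := is_derive_mulf (is_derive_addf (is_derive_mulf dw dw) (is_derive_mulf dw' dw')) de.
  rewrite (_ : (fun t => _) = E); last by apply/funext => t; rewrite /E !expr2.
  move=> d; apply: (is_derive_eq d); field; by rewrite gt_eqF.
have Ele u : 1 <= u -> E u <= E 1.
  move=> u1; apply: (is_derive_le0 u1) => [t /andP[t1 _]|t /andP[t1 _]].
    exact/dE/lt_le_trans/t1.
  apply: mulr_le0_ge0; last exact: expR_ge0.
  rewrite -mulrBl mulr_le0_ge0// ?invr_ge0 ?sqr_ge0//.
  have c1 : 0 <= `|c| - c by rewrite subr_ge0 ler_norm.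
  have c2 : 0 <= `|c| + c by rewrite -[X in _ + X]opprK subr_ge0 -normrN ler_norm.
  (* The sum of these two nonnegative products is [2 |c| (w^2 + w'^2) - 4 c w w']. *)
  have := mulr_ge0 c1 (sqr_ge0 (w t + w' t)).
  have := mulr_ge0 c2 (sqr_ge0 (w t - w' t)).
  lra.
have sqE u : 1 <= u -> w u ^+ 2 + w' u ^+ 2 <= E 1.
  move=> u1; apply: le_trans (Ele u u1).
  rewrite ler_peMr ?addr_ge0 ?sqr_ge0//.
  apply: le_trans (expR_ge1Dx _); rewrite lerDl divr_ge0//.
  exact: le_trans u1.
have absle (x : R) : `|x| <= 1 + x ^+ 2.
  rewrite -real_normK ?num_real//; have := sqr_ge0 (`|x| - 1); nra.
have E0 : 0 <= E 1 by apply: le_trans (sqE 1 _); rewrite ?addr_ge0 ?sqr_ge0.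
exists (1 + E 1) => [|u /sqE uE]; first by rewrite addr_ge0.
have := sqr_ge0 (w u); have := sqr_ge0 (w' u) => w'0 w0.
by split; apply: le_trans (absle _) _; rewrite lerD2l; lra.
Qed.

(* Integrating [u^beta w] by parts twice, via [w'' = (c / u^2 - 1) w], leaves an
   integrand bounded by a multiple of [u^(beta - 2)]. *)
Lemma bessel_primitive_bound nu : exists2 C : R, 0 <= C &
  forall (G : R -> R) (a b : R), 1 <= a -> a <= b ->
  (forall u, a <= u <= b -> is_derive u 1 G (u `^ nu * bessel_phi alpha (u ^+ 2))) ->
  `|G b - G a| <= C * Num.max (a `^ (nu - alpha - 1 / 2)) (b `^ (nu - alpha - 1 / 2)).
Proof.
have [B B0 wB] := bessel_w_bounded.
set be := nu - alpha - 1 / 2.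
pose D := `|c - be * (be - 1)|; have D0 : 0 <= D := normr_ge0 _.
exists (2 * ((1 + `|be|) * B) + D * B) => [|G a b a1 ab dG].
  by have := normr_ge0 be; nra.
set m := Num.max _ _.
have um u : a <= u <= b -> u `^ be <= m.
  by move=> uab; apply: powR_le_max uab; exact: lt_le_trans ltr01 a1.
have m0 : 0 <= m by rewrite le_max powR_ge0.
(* [T] collects the boundary terms of the two integrations by parts; its derivative is the integrand
   up to a multiple of [u^(be - 2) w]. *)
pose T u := - (u `^ be * w' u) + be * (u `^ (be - 1) * w u).
have dT u : 0 < u -> is_derive u 1 T
    (u `^ nu * bessel_phi alpha (u ^+ 2) - (c - be * (be - 1)) * (u `^ (be - 2) * w u)).
  move=> u0; have dw := is_derive_w u0; have dw' := is_derive_w' u0.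
  have d0 := is_derive1_powR be u0; have d1 := is_derive1_powR (be - 1) u0.
  have := is_derive_addf (is_derive_oppf (is_derive_mulf d0 dw'))
    (is_derive_mullf (is_derive_mulf d1 dw) be) => d.
  apply: (is_derive_eq d) => {d}.
  have -> : u `^ nu * bessel_phi alpha (u ^+ 2) = u `^ be * w u.
    rewrite /w mulrA -powRD ?(gt_eqF u0) ?implybT//.
    by congr (_ `^ _ * _); rewrite /be; ring.
  have -> : be - 1 - 1 = be - 2 by ring.
  have -> : u `^ be = u `^ (be - 2) * u * u.
    by rewrite -!powRS//; congr (_ `^ _); ring.
  have -> : u `^ (be - 1) = u `^ (be - 2) * u.
    by rewrite -!powRS//; congr (_ `^ _); ring.
  by field; rewrite gt_eqF.
have Tm u : a <= u <= b -> `|T u| <= (1 + `|be|) * B * m.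
  move=> uab; have u1 : 1 <= u by apply: le_trans a1 _; case/andP: uab.
  have [wu wu'] := wB u u1.
  have p1 : u `^ (be - 1) <= u `^ be by rewrite ler_powR// gerBl.
  apply: le_trans (ler_normD _ _) _.
  rewrite normrN (normrM (_ `^ be)) (normrM be) (normrM (_ `^ (be - 1))).
  rewrite (ger0_norm (powR_ge0 u be)) (ger0_norm (powR_ge0 u (be - 1))).
  rewrite (_ : _ * m = m * B + `|be| * (m * B)); last by ring.
  apply: lerD; first by rewrite ler_pM ?powR_ge0// um.
  apply: ler_wpM2l => //; apply: ler_pM; rewrite ?powR_ge0//.
  exact: le_trans p1 (um u uab).
have a0 : 0 < a := lt_le_trans ltr01 a1.
have pos v : a <= v <= b -> 0 < v.
  by move=> /andP[au _]; exact: lt_le_trans au.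
(* The derivative of [G - T] is at most [D * B * m / u^2] in absolute value, since [u^be <= m] on
   the interval; as [1 <= a], the comparison primitive increases by at most [D * B * m]. *)
have : `|(G b + - T b) - (G a + - T a)| <= - (D * B * m) * b^-1 - - (D * B * m) * a^-1.
  apply: (@is_derive_norm_le _ (fun u => G u + - T u)
    (fun u => (c - be * (be - 1)) * (u `^ (be - 2) * w u))
    (fun u => - (D * B * m) * u^-1) (fun u => D * B * m / u ^+ 2)) => //.
  - move=> u uab; have := is_derive_addf (dG u uab) (is_derive_oppf (dT u (pos u uab))).
    by move=> d; apply: (is_derive_eq d); ring.
  - move=> u /pos u0.
    have di := is_derive_invf (is_derive_id u (1 : R)) (lt0r_neq0 u0).
    have := is_derive_mullf di (- (D * B * m)) => d.
    by apply: (is_derive_eq d); field; rewrite gt_eqF.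
  - move=> u uab; have u0 := pos u uab.
    have u1 : 1 <= u by apply: le_trans a1 _; case/andP: uab.
    have [wu _] := wB u u1.
    rewrite normrM (normrM (_ `^ (be - 2))) (ger0_norm (powR_ge0 u (be - 2))).
    rewrite -/D -!mulrA; apply: ler_wpM2l => //.
    rewrite mulrC ler_pM ?powR_ge0//.
    have -> : u `^ (be - 2) = u `^ be / u ^+ 2.
      by rewrite powRB ?(gt_eqF u0) ?implybT// powR_mulrn// ltW.
    by rewrite ler_wpM2r ?invr_ge0 ?sqr_ge0// um.
have aab : a <= a <= b by rewrite lexx.
have bab : a <= b <= b by rewrite lexx ab.
have := Tm a aab; have := Tm b bab.
have : D * B * m * a^-1 <= D * B * m.
  by rewrite ler_piMr ?mulr_ge0// invf_le1.
have : 0 <= D * B * m * b^-1 by rewrite !mulr_ge0// invr_ge0 ltW// pos.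
move: (T a) (T b) => Ta Tb.
rewrite !mulNr (_ : (2 * _ + _) * m = 2 * ((1 + `|be|) * B * m) + D * B * m); last by ring.
by rewrite !ler_norml; set X := D * B * m; set Y := _ * B * m; lra.
Qed.

Lemma bessel_primitive nu : exists2 C : R, 0 <= C &
  exists2 G : R -> R,
    (forall u, 1 <= u -> is_derive u 1 G (u `^ nu * bessel_phi alpha (u ^+ 2))) &
    forall a b, 1 <= a -> a <= b -> `|G b - G a| <=
      C * Num.max (a `^ (nu - alpha - 1 / 2)) (b `^ (nu - alpha - 1 / 2)).
Proof.
have [C C0 GC] := bessel_primitive_bound nu.
pose k u := u `^ nu * bessel_phi alpha (u ^+ 2).
have ck u : 0 < u -> {for u, continuous k}.
  move=> u0; apply: cvgM; first exact: powR_continuous_at.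
  exact: bessel_phi_sqr_continuous.
(* The base point lies strictly between 0 and 1: the integrand is continuous from there on, and [G]
   has a two-sided derivative also at [u = 1]. *)
pose G u : R := \int[lebesgue_measure]_(t in `[2^-1, u]) k t.
have dG u : 1 <= u -> is_derive u 1 G (u `^ nu * bessel_phi alpha (u ^+ 2)).
  move=> u1; have u0 := lt_le_trans ltr01 u1.
  have u2 : u < u + 1 by rewrite ltrDl.
  have ik : lebesgue_measure.-integrable `[2^-1, (u + 1)] (EFin \o k).
    apply: continuous_itv_integrable => t /andP[t1 _]; apply: ck.
    by apply: lt_le_trans t1; rewrite invr_gt0.
  have lu : 2^-1 < u by apply: lt_le_trans u1; rewrite invf_lt1// ltr1n.
  have [dG G'] := continuous_FTC1_closed u2 ik lu (ck u u0).
  by split => //; rewrite -derive1E G'.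
exists C => //; exists G => // a b a1 ab; apply: GC => // u /andP[au _].
exact/dG/(le_trans a1).
Qed.

Lemma bessel_kernel_continuous (nu r t : R) : 0 < t ->
  {for t, continuous (fun t => t `^ nu * bessel_phi alpha ((r * t) ^+ 2))}.
Proof.
move=> t0; apply: cvgM; first exact: powR_continuous_at.
apply: (cvg_comp (fun t => r * t) (fun z => bessel_phi alpha (z ^+ 2))).
  by apply: cvgMr; exact: cvg_id.
exact: bessel_phi_sqr_continuous.
Qed.

End bessel_function.

(** * Stieltjes integration by parts *)

Section riemann_stieltjes.
Context {R : realType}.
Implicit Types (V E Phi g K P h : R -> R) (M N s x y t : R).

Local Notation leb := lebesgue_measure.

(* [E y - E s] plays the role of the integral of [h] over [(s, y]] against the
   measure of distribution function [V]; since [V] may jump at [x], the increment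
   of [V] over [[x, y]] is only controlled by an interval starting before [x],
   whence the factor 2. *)
Lemma increments_le_stieltjes V E Phi h M N (A D d : R) :
  0 < M -> M <= N -> 0 <= A -> 0 < d ->
  Phi M = 0 -> (forall x, M <= x <= N -> 0 <= E x) ->
  (forall x, M <= x <= N -> E x <= E N) -> 0 <= D ->
  (forall x y, M <= x -> x <= y -> y <= N -> y - x <= d ->
     `|Phi y - Phi x| <= A * (h x * (V y - V x))) ->
  (forall s x y, M <= s -> s < x -> x <= y -> y <= N -> x <= 2 * s -> y <= 2 * x ->
     h x * (V y - V x) <= D * (E y - E s)) ->
  (forall y, M <= y -> y <= N -> y <= 2 * M -> h M * (V y - V M) <= D * E y) ->
  `|Phi N| <= 2 * (A * D * E N).
Proof.
move=> M0 + A0 d0 PhiM E0 EN D0 Hphi H2 H3.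
rewrite le_eqVlt => /predU1P[MN|MN].
  by rewrite -MN in E0 *; rewrite PhiM normr0 !mulr_ge0// E0 ?lexx.
have NM0 : 0 < N - M by rewrite subr_gt0.
(* A mesh at most [d] makes the local estimate [Hphi] available; a mesh at most [M / 2] keeps
   consecutive points within a factor 2, as [H2] and [H3] require. *)
pose q : R := Num.min d (M / 2).
have q0 : 0 < q by rewrite lt_min d0 divr_gt0.
pose n := Num.truncn ((N - M) / q).
pose e := (N - M) / n.+1%:R.
have n0 : 0 < n.+1%:R :> R by [].
have e0 : 0 < e by rewrite divr_gt0.
have eq : e <= q.
  rewrite /e ler_pdivrMr// mulrC -ler_pdivrMr//.
  by apply: ltW; exact: truncnS_gt.
have [ed eM] : e <= d /\ e <= M / 2.
  by move: eq; rewrite /q le_min => /andP[].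
pose t i : R := M + i%:R * e.
have tS i : t i.+1 = t i + e by rewrite /t -natr1; ring.
have t0 : t 0%N = M by rewrite /t mul0r addr0.
have tN : t n.+1 = N by rewrite /t /e mulrC divfK ?gt_eqF// addrC subrK.
have tge i : M <= t i by rewrite /t lerDl mulr_ge0// ltW.
have tle i : (i <= n.+1)%N -> t i <= N.
  by move=> ni; rewrite -tN /t lerD2l ler_wpM2r ?ler_nat// ltW.
(* Each increment of [Phi] costs [E (t i.+2) - E (t i)], an overlap of two cells, and these
   differences telescope to the sum of the last two values of [E]. *)
have step i : (i <= n)%N -> `|Phi (t i.+1)| <= A * (D * (E (t i.+1) + E (t i))).
  elim: i => [_|i IH ni].
    rewrite -[Phi _]subr0 -PhiM -[in Phi M]t0.
    apply: le_trans (Hphi _ _ _ _ _ _) _; rewrite ?tS ?t0 ?lexx//.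
    - by rewrite lerDl ltW.
    - by rewrite -t0 -tS tle.
    - by rewrite addrAC subrr add0r.
    - rewrite ler_wpM2l// (le_trans (H3 _ _ _ _)) ?lerDl ?(ltW e0)//.
      + by rewrite -t0 -tS tle.
      + lra.
      + by rewrite ler_wpM2l// lerDl E0// lexx ltW.
  have H : `|Phi (t i.+2) - Phi (t i.+1)| <= A * (D * (E (t i.+2) - E (t i))).
    apply: le_trans (Hphi _ _ _ _ _ _) _; rewrite ?tge ?tle//.
    - by rewrite (tS i.+1) lerDl ltW.
    - by rewrite (tS i.+1) addrAC subrr add0r.
    - have Mi := tge i; rewrite ler_wpM2l// H2 ?tge ?tle//.
      + by rewrite tS ltrDl.
      + by rewrite (tS i.+1) lerDl ltW.
      + by rewrite tS; lra.
      + by rewrite !tS; lra.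
  rewrite -[Phi (t i.+2)](subrK (Phi (t i.+1))).
  apply: le_trans (ler_normD _ _) _.
  apply: le_trans (lerD H (IH (ltnW ni))) _.
  by rewrite -mulrDr ler_wpM2l// -mulrDr ler_wpM2l//; lra.
rewrite -tN; apply: le_trans (step n (leqnn n)) _.
have := EN (t n); rewrite tN tge tle// => /(_ isT) Etn.
rewrite (_ : 2 * _ = A * (D * (2 * E N))); last by ring.
by do 2 apply: ler_wpM2l => //; lra.
Qed.

Lemma integrableM_bounded g K (D : set R) (B : R) : measurable D ->
  leb.-integrable D (EFin \o g) -> measurable_fun D K ->
  (forall t, D t -> `|K t| <= B) -> leb.-integrable D (EFin \o (fun t => g t * K t)).
Proof.
move=> mD ig mK KB; rewrite (_ : EFin \o _ = (EFin \o g) \* (EFin \o K))%E//.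
apply: integrableMl => //; exists B; split; first exact: num_real.
by move=> x Bx t /= Dt; rewrite (le_trans (KB t Dt))// ltW.
Qed.

Lemma continuous_itv_bounded K M N : M <= N ->
  (forall t, M <= t <= N -> {for t, continuous K}) ->
  exists2 B : R, 0 <= B & forall t, M <= t <= N -> `|K t| <= B.
Proof.
move=> MN cK.
have cf : {within `[M, N], continuous (fun t => `|K t|)}.
  apply: for_within_continuous => t /=; rewrite in_itv/= => /cK.
  exact: cvg_norm.
by have [c _ cmax] := EVT_max MN cf; exists `|K c|.
Qed.

Lemma continuous_itv_measurable K M N (x y : bool) :
  (forall t, M <= t <= N -> {for t, continuous K}) ->
  measurable_fun [set` Interval (BSide x M) (BSide y N)] K.
Proof.
move=> cK; have /integrableP[/measurable_EFinP//] :
  leb.-integrable [set` Interval (BSide x M) (BSide y N)] (EFin \o K).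
exact: continuous_itv_integrable.
Qed.

(** [Phi x] stands for minus the Stieltjes integral of [P] against [dg] over [[M, x]], without that
    integral being defined. Its increment over a short [[x, y]] is the integral of
    [(g t - g y) * K t] minus [(g y - g x) * P x], and each of the two is at most [A * h x] times
    the increment of [V]. These two pieces and the factor 2 of [increments_le_stieltjes] make up the
    constant 4. *)
Lemma Rintegral_by_parts_bound g V E P K h M N (A D : R) :
  0 < M -> M <= N -> 0 < A -> 0 <= D ->
  leb.-integrable `[M, N] (EFin \o g) ->
  (forall t, M <= t <= N -> {for t, continuous K}) ->
  (forall t, M <= t <= N -> is_derive t 1 P (K t)) ->
  (forall t, M <= t <= N -> `|P t| <= A * h t) ->
  (exists2 m, 0 < m & forall t, M <= t <= N -> m <= h t) ->
  (forall x y, M <= x -> x <= y -> `|g y - g x| <= V y - V x) ->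
  (forall x, M <= x <= N -> 0 <= E x) ->
  (forall x, M <= x <= N -> E x <= E N) ->
  (forall s x y, M <= s -> s < x -> x <= y -> y <= N -> x <= 2 * s -> y <= 2 * x ->
     h x * (V y - V x) <= D * (E y - E s)) ->
  (forall y, M <= y -> y <= N -> y <= 2 * M -> h M * (V y - V M) <= D * E y) ->
  `|\int[leb]_(t in `[M, N]) (g t * K t)| <=
    A * (`|g N| * h N + `|g M| * h M + 4 * (D * E N)).
Proof.
move=> M0 MN A0 D0 ig cK dP PA [m m0 mh] gV E0 EN H2 H3.
have [B B0 KB] := continuous_itv_bounded MN cK.
pose Phi x := \int[leb]_(t in `[M, x]) (g t * K t) - g x * P x + g M * P M.
have igK : leb.-integrable `[M, N] (EFin \o (fun t => g t * K t)).
  apply: (integrableM_bounded _ ig (B := B)) => //.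
  exact: continuous_itv_measurable.
have PhiM : Phi M = 0 by rewrite /Phi set_itv1 Rintegral_set1 sub0r addNr.
(* With [y - x <= d] the integral of a function bounded by [B] is at most [A * m <= A * h x]; the
   [+ 1] keeps the denominator positive. *)
pose d := A * m / (B + 1).
have B1 : 0 < B + 1 by rewrite ltr_wpDl.
have d0 : 0 < d by rewrite divr_gt0// mulr_gt0.
have Hphi x y : M <= x -> x <= y -> y <= N -> y - x <= d ->
    `|Phi y - Phi x| <= 2 * A * (h x * (V y - V x)).
  move=> Mx xy yN yxd.
  have My := le_trans Mx xy; have xN := le_trans xy yN.
  have igKxy : leb.-integrable `]x, y] (EFin \o (fun t => g t * K t)).
    by apply: integrableS igK => //; apply: subset_itv; rewrite bnd_simp.
  have -> : Phi y - Phi x = \int[leb]_(t in `]x, y]) ((g t - g y) * K t)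
      - (g y - g x) * P x.
    have Iyx : \int[leb]_(t in `[M, y]) (g t * K t)
        - \int[leb]_(t in `[M, x]) (g t * K t) = \int[leb]_(t in `]x, y]) (g t * K t).
      apply: Rintegral_itvB; rewrite ?bnd_simp//.
      by apply: integrableS igK => //; apply: subset_itv; rewrite bnd_simp.
    have IK : \int[leb]_(t in `]x, y]) K t = P y - P x.
      have IKxy : leb.-integrable `]x, y] (EFin \o K).
        apply: continuous_itv_integrable => t /andP[xt ty].
        by apply: cK; rewrite (le_trans Mx xt) (le_trans ty yN).
      rewrite Rintegral_itv_obnd_cbnd//.
      apply: Rintegral_is_derive => // t /andP[xt ty].
        by apply: dP; rewrite (le_trans Mx xt) (le_trans ty yN).
      by apply: cK; rewrite (le_trans Mx xt) (le_trans ty yN).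
    have -> : \int[leb]_(t in `]x, y]) ((g t - g y) * K t) =
        \int[leb]_(t in `]x, y]) (g t * K t) - g y * (P y - P x).
      rewrite -IK -RintegralZl//; last first.
        apply: continuous_itv_integrable => t /andP[xt ty].
        by apply: cK; rewrite (le_trans Mx xt) (le_trans ty yN).
      rewrite -RintegralB//.
      - by under eq_Rintegral do rewrite mulrBl.
      - apply: continuous_itv_integrable => t /andP[xt ty].
        by apply: cvgMr; apply: cK; rewrite (le_trans Mx xt) (le_trans ty yN).
    by rewrite /Phi -Iyx; ring.
  have Vyx : 0 <= V y - V x by apply: le_trans (gV x y Mx xy).
  have I1 : `|\int[leb]_(t in `]x, y]) ((g t - g y) * K t)| <= (V y - V x) * (A * h x).
    have igy : leb.-integrable `]x, y] (EFin \o (fun t => g t - g y)).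
      apply: (@integrableB _ _ _ leb _ _ (EFin \o g) (EFin \o cst (g y))) => //.
        by apply: integrableS ig => //; apply: subset_itv; rewrite bnd_simp.
      by apply: continuous_itv_integrable => t _; exact: cvg_cst.
    have igyK : leb.-integrable `]x, y] (EFin \o (fun t => (g t - g y) * K t)).
      apply: (integrableM_bounded _ igy (B := B)) => //.
        apply: continuous_itv_measurable => t /andP[xt ty].
        by apply: cK; rewrite (le_trans Mx xt) (le_trans ty yN).
      move=> t /=; rewrite in_itv/= => /andP[xt ty].
      by apply: KB; rewrite (le_trans Mx (ltW xt)) (le_trans ty yN).
    apply: le_trans (le_normr_Rintegral _ igyK) _ => //.
    apply: (@le_trans _ _ (\int[leb]_(t in `]x, y]) ((V y - V x) * B))).
      apply: le_Rintegral => //.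
      - exact: integrable_norm igyK.
      - by apply: continuous_itv_integrable => t _; exact: cvg_cst.
      - move=> t /=; rewrite in_itv/= => /andP[xt ty].
        rewrite normrM ler_pM//; last first.
          by apply: KB; rewrite (le_trans Mx (ltW xt)) (le_trans ty yN).
        have Mt := le_trans Mx (ltW xt).
        rewrite distrC (le_trans (gV _ _ Mt ty))// lerD2l lerN2.
        have := le_trans (normr_ge0 _) (gV _ _ Mx (ltW xt)); lra.
    rewrite Rintegral_cst//= lebesgue_measure_itv/= lte_fin.
    rewrite (_ : fine _ = y - x); last first.
      by case: ltgtP xy => [//||->] //= _; rewrite subrr.
    rewrite -mulrA ler_wpM2l//.
    apply: (@le_trans _ _ (B * d)); first by rewrite ler_wpM2l.
    apply: (@le_trans _ _ (A * m)).
      rewrite /d mulrCA ler_piMr ?mulr_ge0 ?(ltW A0) ?(ltW m0)//.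
      by rewrite ler_pdivrMr// mul1r lerDl.
    by apply: ler_wpM2l; [exact: ltW|apply: mh; rewrite Mx].
  have I2 : `|(g y - g x) * P x| <= (V y - V x) * (A * h x).
    by rewrite normrM ler_pM// ?gV// PA// Mx.
  apply: le_trans (ler_normB _ _) _.
  rewrite (_ : 2 * A * _ = (V y - V x) * (A * h x) + (V y - V x) * (A * h x)).
    exact: lerD.
  by ring.
have A20 : 0 <= 2 * A by rewrite mulr_ge0// ltW.
have := increments_le_stieltjes M0 MN A20 d0 PhiM E0 EN D0 Hphi H2 H3.
have -> : \int[leb]_(t in `[M, N]) (g t * K t) = Phi N + g N * P N - g M * P M.
  by rewrite /Phi; ring.
move=> PhiN.
have MMN : M <= M <= N by rewrite lexx.
have NMN : M <= N <= N by rewrite lexx MN.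
have gN : `|g N * P N| <= `|g N| * (A * h N) by rewrite normrM ler_wpM2l// PA.
have gM : `|g M * P M| <= `|g M| * (A * h M) by rewrite normrM ler_wpM2l// PA.
apply: le_trans (ler_normB _ _) _; apply: le_trans (lerD (ler_normD _ _) (lexx _)) _.
by rewrite !mulrDr; lra.
Qed.

End riemann_stieltjes.

(** * The measure of total variation and its comparison with increments *)

Section variation_measure.
Context {R : realType}.
Variables (f : R -> R[i]) (M : R).
Hypothesis bvf : forall b, M < b -> cbounded_variation M b f.
Implicit Types (s t x y be : R).

Local Notation V := (tv_from f M).
Local Notation W := (tv_from_right f M).
Local Notation mu := (lebesgue_stieltjes_measure W).

Lemma tv_fromE t : M <= t -> (V t)%:E = ctotal_variation M t f.
Proof.
move=> Mt; rewrite /tv_from asboolT//= Mt fineK//.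
move: Mt; rewrite le_eqVlt => /predU1P[<-|Mt]; last exact/ctotal_variation_fin/bvf/Mt/ltW.
apply: ctotal_variation_fin => //; exists 0 => _ [s /itv_partitionxx -> <-].
by rewrite /cvariation big_nil.
Qed.

(** Appending [y] to a partition of [[M, x]] gives a partition of [[M, y]]. *)
Lemma normc_increment_le_tv_from x y : M <= x -> x <= y ->
  Normc.normc (f y - f x) <= V y - V x.
Proof.
move=> Mx; rewrite le_eqVlt => /predU1P[->|xy]; first by rewrite !subrr Normc.normc0.
rewrite lerBrDr addrC -lerBrDr -lee_fin tv_fromE//.
apply: ge_ereal_sup => _ [_ [s Mxs <-] <-]; rewrite lee_fin lerBrDr.
rewrite -(cvariation_rcons _ _ Mxs) -lee_fin tv_fromE ?(le_trans Mx (ltW xy))//.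
apply: ereal_sup_ubound => /=; exists (cvariation M y f (rcons s y)) => //.
exists (rcons s y) => //; case: Mxs => ps /eqP ls.
by split; rewrite ?last_rcons// rcons_path ps ls.
Qed.

Lemma tv_from_lt t : t < M -> V t = 0.
Proof. by move=> tM; rewrite /tv_from leNgt tM andbF. Qed.

Lemma tv_from_ge0 t : 0 <= V t.
Proof.
have [tM|Mt] := ltP t M; first by rewrite tv_from_lt.
rewrite -(@tv_from_lt (M - 1)) ?ltrBlDr ?ltrDl//; apply: tv_from_nd.
by rewrite (le_trans _ Mt)// gerBl.
Qed.

Lemma tv_from_right_lt t : t < M -> W t = 0.
Proof.
move=> tM; apply/eqP; rewrite eq_le; apply/andP; split.
  have h : t < (t + M) / 2 by rewrite midf_lt.
  apply: le_trans (tv_from_right_le f M h) _.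
  by rewrite tv_from_lt// midf_lt.
exact: le_trans (tv_from_ge0 t) (tv_from_right_ge f M t).
Qed.

Lemma variation_measure_itv_oc s t : s <= t -> mu `]s, t]%classic = (W t - W s)%:E.
Proof.
move=> st; rewrite /lebesgue_stieltjes_measure /measure_extension.
by rewrite measurable_mu_extE/= ?wlength_itv_bnd//; exact: is_ocitv.
Qed.

(** The interval is exhausted by half-open ones on which [W] is zero. Hence a half-open interval
    that starts left of [M] carries only the mass in [[M, +oo[], including the atom at [M]. *)
Lemma variation_measure_lt s : mu `]s, M[%classic = 0%E.
Proof.
apply: measure_negligible => //.
pose I n : set (measurableTypeR R) := `]s, (M - n.+1%:R^-1)]%classic.
apply: (negligibleS (A := \bigcup_n I n)).
  move=> t /=; rewrite in_itv/= => /andP[st tM].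
  exists (Num.truncn (M - t)^-1) => //; rewrite /I/= in_itv/= st lerBrDl -lerBrDr.
  have Mt : 0 < M - t by rewrite subr_gt0.
  rewrite -[leRHS]invrK lef_pV2 ?posrE ?invr_gt0//.
  by apply: ltW; exact: truncnS_gt.
apply: negligible_bigcup => n; apply/negligibleP; first exact: measurable_itv.
have nM : M - n.+1%:R^-1 < M by rewrite ltrBlDr ltrDl.
rewrite /I; have [sn|sn] := leP s (M - n.+1%:R^-1).
  apply: etrans (variation_measure_itv_oc sn) _.
  by rewrite !tv_from_right_lt ?subrr// (le_lt_trans sn).
by rewrite set_itv_ge ?measure0// bnd_simp -leNgt ltW.
Qed.

(** The mass is [W y - W s]. The strict inequality [s < x] gives [W s <= V x], whereas [W x] may
    exceed [V x] when [f] jumps at [x]. *)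
Lemma tv_increment_le_measure s x y : s < x -> x <= y ->
  ((V y - V x)%:E <= mu `]s, y]%classic)%E.
Proof.
move=> sx xy; rewrite variation_measure_itv_oc; last exact: le_trans (ltW sx) xy.
by rewrite lee_fin lerB ?tv_from_right_ge ?tv_from_right_le.
Qed.

Lemma tv_from_le_measure y : M <= y -> ((V y)%:E <= mu `[M, y]%classic)%E.
Proof.
move=> My; have M1 : M - 1 < M by rewrite ltrBlDr ltrDl.
rewrite -[V y]subr0 -(tv_from_lt M1).
have M2 : M - 1 - 1 < M - 1 by rewrite ltrBlDr ltrDl.
apply: le_trans (tv_increment_le_measure M2 _) _; first exact: le_trans (ltW M1) My.
have <- : `]M - 1 - 1, M[%classic `|` `[M, y]%classic = `]M - 1 - 1, y]%classic.
  by rewrite -itv_bndbnd_setU// bnd_simp (lt_trans M2).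
pose A : set (measurableTypeR R) := `]M - 1 - 1, M[%classic.
apply: (@le_trans _ _ (mu A + mu `[M, y]%classic)%E).
  by apply: measureU2; exact: measurable_itv.
by rewrite variation_measure_lt add0e.
Qed.

Variable be : R.
Hypothesis M_gt0 : 0 < M.

Local Notation J := (tv_integral f M (fun t => t `^ be)).
Hypothesis J_fin : (J < +oo)%E.

(** The ratio [x / t] lies in [[1/2, 2]]; the absolute value in [2^|be|] covers both signs of the
    exponent. *)
Lemma powR_doubling x t : 0 < x -> x <= 2 * t -> t <= 2 * x ->
  x `^ be <= 2 `^ `|be| * t `^ be.
Proof.
move=> x0 xt tx; have t0 : 0 < t by lra.
have -> : x `^ be = (x / t) `^ be * t `^ be.
  by rewrite -powRM ?divr_ge0 ?(ltW x0) ?(ltW t0)// divfK// gt_eqF.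
rewrite ler_wpM2r ?powR_ge0//.
have h : 2^-1 <= x / t <= 2.
  by apply/andP; split; [rewrite ler_pdivlMr//|rewrite ler_pdivrMr//]; lra.
apply: le_trans (powR_le_max be _ h) _; first by rewrite invr_gt0.
rewrite ge_max; apply/andP; split; last by rewrite ler_powR ?ler1n// ler_norm.
rewrite -powR_inv1// -powRrM mulN1r ler_powR ?ler1n//.
by rewrite -normrN ler_norm.
Qed.

(** The concrete [E] for [Rintegral_by_parts_bound], used with [h t = t^be] and [D = 2^|be|]; the
    finiteness of [J] makes [fine] harmless. *)
Let E y : R := fine (\int[mu]_(t in `[M, y]) (t `^ be)%:E)%E.

Let measurable_integrand (A : set (measurableTypeR R)) :
  measurable_fun A (fun t : measurableTypeR R => (t `^ be)%:E).
Proof. exact: measurable_powR_EFin. Qed.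

Let integrand_ge0 (t : R) : (0 <= (t `^ be)%:E)%E.
Proof. by rewrite lee_fin powR_ge0. Qed.

Let integral_le_J (A : set (measurableTypeR R)) : measurable A -> A `<=` `[M, +oo[ ->
  (\int[mu]_(t in A) (t `^ be)%:E <= J)%E.
Proof.
by move=> mA AM; apply: ge0_subset_integral.
Qed.

Let integral_fin (A : set (measurableTypeR R)) : measurable A -> A `<=` `[M, +oo[ ->
  (\int[mu]_(t in A) (t `^ be)%:E)%E \is a fin_num.
Proof.
move=> mA AM; rewrite ge0_fin_numE ?integral_ge0//.
exact: le_lt_trans (integral_le_J mA AM) J_fin.
Qed.

Let itv_M y : `[M, y] `<=` `[M, +oo[.
Proof. by apply: subset_itv; rewrite bnd_simp. Qed.

Let EE y : (E y)%:E = (\int[mu]_(t in `[M, y]) (t `^ be)%:E)%E.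
Proof. by rewrite /E fineK// integral_fin//; exact: measurable_itv. Qed.

Let E_ge0 y : 0 <= E y.
Proof. by rewrite -lee_fin EE integral_ge0. Qed.

Let E_nd x y : x <= y -> E x <= E y.
Proof.
move=> xy; rewrite -lee_fin !EE; apply: ge0_subset_integral => //.
by apply: subset_itv; rewrite bnd_simp.
Qed.

Let E_leJ y : E y <= fine J.
Proof.
rewrite -lee_fin EE fineK; first by apply: integral_le_J => //; exact: measurable_itv.
by rewrite ge0_fin_numE// integral_ge0.
Qed.

Let integral_ge_cst (A : set (measurableTypeR R)) x : measurable A -> 0 < x ->
  (forall t, A t -> x <= 2 * t /\ t <= 2 * x) ->
  ((x `^ be / 2 `^ `|be|)%:E * mu A <= \int[mu]_(t in A) (t `^ be)%:E)%E.
Proof.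
move=> mA x0 Ax; rewrite -integral_cst//; apply: ge0_le_integral => //.
  by move=> t _; rewrite lee_fin divr_ge0 ?powR_ge0.
move=> t /Ax[xt tx]; rewrite lee_fin ler_pdivrMr ?powR_gt0// mulrC.
exact: powR_doubling.
Qed.

(** Every point of []s, y]] is within a factor 2 of [x], so the weight there is at least
    [x^be / 2^|be|]. *)
Let E_increment s x y : M <= s -> s < x -> x <= y -> x <= 2 * s -> y <= 2 * x ->
  x `^ be * (V y - V x) <= 2 `^ `|be| * (E y - E s).
Proof.
move=> Ms sx xy xs yx; have x0 : 0 < x by lra.
have sy := le_trans (ltW sx) xy.
have Esy : (\int[mu]_(t in `]s, y]) (t `^ be)%:E)%E = (E y - E s)%:E.
  apply/eqP; rewrite EFinB eq_sym sube_eq//; last by rewrite fin_num_adde_defl.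
  rewrite !EE addeC -ge0_integral_setU//.
  - by rewrite -itv_bndbnd_setU// bnd_simp.
  - apply/disj_setPS => t [/=]; rewrite !in_itv/= => /andP[_ ts] /andP[st _].
    by move: (lt_le_trans st ts); rewrite ltxx.
rewrite -ler_pdivrMl ?powR_gt0// mulrA (mulrC _ (x `^ be)) -lee_fin -Esy EFinM.
apply: le_trans (integral_ge_cst _ x0 _).
- by rewrite lee_wpmul2l ?lee_fin ?divr_ge0 ?powR_ge0// tv_increment_le_measure.
- exact: measurable_itv.
- by move=> t /=; rewrite in_itv/= => /andP[st ty]; split; lra.
Qed.

Let E_increment0 y : M <= y -> y <= 2 * M ->
  M `^ be * (V y - V M) <= 2 `^ `|be| * E y.
Proof.
move=> My yM.
rewrite -ler_pdivrMl ?powR_gt0// mulrA (mulrC _ (M `^ be)) -lee_fin EE EFinM.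
apply: le_trans (integral_ge_cst _ M_gt0 _).
- rewrite lee_wpmul2l ?lee_fin ?divr_ge0 ?powR_ge0//.
  apply: le_trans (tv_from_le_measure My).
  by rewrite lee_fin gerBl tv_from_ge0.
- exact: measurable_itv.
- by move=> t /=; rewrite in_itv/= => /andP[st ty]; split; lra.
Qed.

Lemma Rintegral_variation_bound (g K P : R -> R) (A N : R) : M <= N -> 0 < A ->
  (lebesgue_measure).-integrable `[M, N] (EFin \o g) ->
  (forall x y, `|g y - g x| <= Normc.normc (f y - f x)) ->
  (forall t, M <= t <= N -> {for t, continuous K}) ->
  (forall t, M <= t <= N -> is_derive t 1 P (K t)) ->
  (forall t, M <= t <= N -> `|P t| <= A * t `^ be) ->
  `|\int[lebesgue_measure]_(t in `[M, N]) (g t * K t)| <=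
    A * (`|g N| * N `^ be + `|g M| * M `^ be + 4 * (2 `^ `|be| * fine J)).
Proof.
move=> MN A0 ig gf cK dP PA.
apply: (@le_trans _ _ (A * (`|g N| * N `^ be + `|g M| * M `^ be
    + 4 * (2 `^ `|be| * E N)))); last first.
  by rewrite ler_pM2l// lerD2l ler_pM2l// ler_pM2l ?powR_gt0.
apply: (@Rintegral_by_parts_bound _ g V E P K (fun t => t `^ be)) => //.
- exists (Num.min (M `^ be) (N `^ be)).
    by rewrite lt_min !powR_gt0// (lt_le_trans M_gt0).
  move=> t /andP[Mt tN]; have t0 := lt_le_trans M_gt0 Mt.
  rewrite ge_min; have [p0|/ltW p0] := leP 0 be.
    by rewrite ge0_ler_powR ?nnegrE ?(ltW t0) ?(ltW M_gt0).
  apply/orP; right; rewrite -(opprK be) !(powRN _ (- _)).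
  rewrite lef_pV2 ?posrE ?powR_gt0 ?(lt_le_trans t0)//.
  by rewrite ge0_ler_powR ?oppr_ge0 ?nnegrE ?(ltW t0)// (le_trans (ltW t0)).
- by move=> x y Mx xy; apply: le_trans (gf x y) (normc_increment_le_tv_from Mx xy).
- by move=> x /andP[_ xN]; exact: E_nd.
- by move=> s x y Ms sx xy _; exact: E_increment.
- by move=> y My _; exact: E_increment0.
Qed.

End variation_measure.

(** * Uniform convergence *)

Section real_estimates.
Context {R : realType}.
Variables (alpha nu mu : R) (f : R -> R[i]).
Hypothesis alpha_ge : - (1 / 2) <= alpha.
Hypothesis munu_gt0 : 0 < mu + nu.
Hypothesis munu_le : mu + nu <= alpha + 3 / 2.
Hypothesis bvf : locally_bounded_variation f.

Local Notation leb := lebesgue_measure.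
Local Notation be := (nu - alpha - 1 / 2).
Local Notation kap := (mu + nu - alpha - 3 / 2).
Local Notation mass M := (lebesgue_stieltjes_measure (tv_from_right f M)).
Local Notation J M := (tv_integral f M (fun t => t `^ be)).

Let kap_le0 : kap <= 0.
Proof. by move: munu_le; lra. Qed.

Lemma bvf_from M : 0 < M -> forall b, M < b -> cbounded_variation M b f.
Proof. by move=> M0 b; exact: bvf. Qed.

Lemma near_pinfty_ge (P : R -> Prop) : (\forall M \near +oo, P M) ->
  exists2 M0, 0 < M0 & forall M, M0 <= M -> P M.
Proof.
move=> [A [_ PA]]; exists (Num.max A 0 + 1).
  by rewrite ltr_wpDl// le_max lexx orbT.
move=> M AM; apply: PA; apply: lt_le_trans AM.
by rewrite ltr_pwDr// le_max lexx.
Qed.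

Lemma tv_integral_cst1 M : tv_integral f M (fun=> 1) = mass M `[M, +oo[%classic.
Proof. by rewrite /tv_integral integral_cst ?mul1e//; exact: measurable_itv. Qed.

Hypothesis hdf1 : nu < alpha + 1 / 2 -> mu < 1 ->
  ereal_littleo (fun M => tv_integral f M (fun=> 1)) (fun M => M `^ (mu - 1)).
Hypothesis hdf2 : alpha + 1 / 2 <= nu \/ 1 <= mu ->
  ereal_littleo (fun M => tv_integral f M (fun t => t `^ (nu - alpha - 1 / 2)))
    (fun M => M `^ (mu + nu - alpha - 3 / 2)).

(** In the range of [hdf2] this is the hypothesis itself. In the range of [hdf1], [be < 0], so
    [t^be <= M^be] on [[M, +oo[], and [be + (mu - 1) = kap]. *)
Lemma tv_integral_small e : 0 < e -> exists2 M0 : R, 0 < M0 &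
  forall M, M0 <= M -> (J M <= (e * M `^ kap)%:E)%E.
Proof.
move=> e0; have [nu1|nu1] := leP (alpha + 1 / 2) nu; last have [mu1|mu1] := leP 1 mu.
1,2: have h2 : alpha + 1 / 2 <= nu \/ 1 <= mu by [left|right].
1,2: have [M0 M00 JM] := near_pinfty_ge (hdf2 h2 e0); exists M0 => // M M0M.
1,2: by apply: le_trans (lee_abs _) _; rewrite -[_ `^ kap]ger0_norm ?powR_ge0// JM.
have [M0 M00 JM] := near_pinfty_ge (hdf1 nu1 mu1 e0); exists M0 => // M M0M.
have M0' : 0 < M := lt_le_trans M00 M0M.
have := le_trans (lee_abs _) (JM _ M0M); rewrite tv_integral_cst1 ger0_norm ?powR_ge0// => mM.
apply: (@le_trans _ _ ((M `^ be)%:E * mass M `[M, +oo[%classic)%E).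
  rewrite /tv_integral -integral_cst; last exact: measurable_itv.
  apply: ge0_le_integral => //.
  - by move=> t _; rewrite lee_fin powR_ge0.
  - exact: measurable_powR_EFin.
  - move=> t /=; rewrite in_itv/= andbT => Mt; have t0 := lt_le_trans M0' Mt.
    rewrite lee_fin -(opprK be) !(powRN _ (- _)) lef_pV2 ?posrE ?powR_gt0//.
    rewrite ge0_ler_powR ?nnegrE ?(ltW t0) ?(ltW M0')//; lra.
apply: le_trans (lee_wpmul2l _ mM) _; first by rewrite lee_fin powR_ge0.
rewrite -EFinM lee_fin mulrCA ler_wpM2l ?(ltW e0)// -powRD ?(gt_eqF M0') ?implybT//.
by rewrite le_eqVlt; apply/orP; left; apply/eqP; congr (_ `^ _); field.
Qed.

(** If [be < 0], [hdf1] applies directly. If [0 <= be], then [M^be <= t^be] on [[M, y]], and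
    dividing the bound on [J M] by [M^be] turns [kap] into [mu - 1]. *)
Lemma tv_from_small e : mu < 1 -> 0 < e -> exists2 M0 : R, 0 < M0 &
  forall M y, M0 <= M -> M <= y -> tv_from f M y <= e * M `^ (mu - 1).
Proof.
move=> mu1 e0; have [nu1|nu1] := leP (alpha + 1 / 2) nu; last first.
  have [M0 M00 JM] := near_pinfty_ge (hdf1 nu1 mu1 e0); exists M0 => // M y M0M My.
  have Mp : 0 < M := lt_le_trans M00 M0M.
  have := le_trans (lee_abs _) (JM _ M0M); rewrite tv_integral_cst1 ger0_norm ?powR_ge0// => mM.
  rewrite -lee_fin; apply: le_trans mM; apply: le_trans (tv_from_le_measure f My) _.
  apply: le_measure; rewrite ?inE; [exact: measurable_itv|exact: measurable_itv|].
  by apply: subset_itv; rewrite bnd_simp.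
have [M0 M00 JM] := tv_integral_small e0; exists M0 => // M y M0M My.
have Mp : 0 < M := lt_le_trans M00 M0M.
have p0 : 0 < M `^ be by rewrite powR_gt0.
rewrite -(ler_pM2l p0) -lee_fin EFinM.
apply: (@le_trans _ _ ((M `^ be)%:E * mass M `[M, y]%classic)%E).
  by rewrite lee_wpmul2l ?lee_fin ?(ltW p0)// tv_from_le_measure.
rewrite -integral_cst; last exact: measurable_itv.
apply: (@le_trans _ _ (\int[mass M]_(t in `[M, y]) (t `^ be)%:E)%E).
  apply: ge0_le_integral => //.
  - by move=> t _; rewrite lee_fin powR_ge0.
  - exact: measurable_powR_EFin.
  - move=> t /=; rewrite in_itv/= => /andP[Mt _].
    rewrite lee_fin ge0_ler_powR ?nnegrE ?(ltW Mp)//; first lra.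
    exact: le_trans (ltW Mp) Mt.
apply: (@le_trans _ _ (J M)).
  apply: ge0_subset_integral => //.
  - exact: measurable_powR_EFin.
  - by move=> t _; rewrite lee_fin powR_ge0.
  - by apply: subset_itv; rewrite bnd_simp.
apply: le_trans (JM _ M0M) _.
rewrite lee_fin mulrCA ler_wpM2l ?(ltW e0)// -powRD ?(gt_eqF Mp) ?implybT//.
by rewrite le_eqVlt; apply/orP; left; apply/eqP; congr (_ `^ _); field.
Qed.

Section real_function.
Variable g : R -> R.
Hypothesis gf : forall x y, `|g y - g x| <= Normc.normc (f y - f x).
Hypothesis g_cvg0 : g t @[t --> +oo] --> 0.
Hypothesis g_int : forall M N, 0 < M -> M <= N -> leb.-integrable `[M, N] (EFin \o g).

(** If [1 <= mu], the right-hand side is at least [e] once [1 <= M], and [g] tends to 0. If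
    [mu < 1], [|g M|] is at most [|g y|] plus the variation from [M] to [y], with [g y] arbitrarily
    small for distant [y]. *)
Lemma vanishing_small e : 0 < e -> exists2 M0 : R, 0 < M0 &
  forall M, M0 <= M -> `|g M| <= e * M `^ (mu - 1).
Proof.
move=> e0.
have small d : 0 < d -> exists2 M0, 0 < M0 & forall M, M0 <= M -> `|g M| <= d.
  move=> d0; have /cvgrPdist_le/(_ d d0)/near_pinfty_ge[M0 M00 gM] := g_cvg0.
  by exists M0 => // M /gM; rewrite sub0r normrN.
have [mu1|mu1] := leP 1 mu.
  have [M0 M00 gM] := small e e0; exists (Num.max M0 1).
    by rewrite lt_max M00.
  move=> M; rewrite ge_max => /andP[/gM gMe M1]; apply: le_trans gMe _.
  by rewrite ler_peMr ?(ltW e0)// -[leLHS](powRr0 M) ler_powR// subr_ge0.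
have [M0 M00 VM] := tv_from_small mu1 e0; exists M0 => // M M0M.
have Mp : 0 < M := lt_le_trans M00 M0M.
apply/ler_addgt0Pr => d d0; have [y0 _ gy] := small d d0.
pose y := Num.max M y0.
have My : M <= y by rewrite le_max lexx.
have gyd : `|g y| <= d by apply: gy; rewrite le_max lexx orbT.
have := le_trans (gf M y) (normc_increment_le_tv_from (bvf_from Mp) (lexx M) My).
have := VM M y M0M My; have := tv_from_ge0 f M M.
move: gyd; rewrite distrC !ler_norml; lra.
Qed.

Local Notation ker r t := (t `^ nu * bessel_phi alpha ((r * t) ^+ 2)).

Lemma high_frequency_small e : 0 < e -> exists2 M0 : R, 0 < M0 &
  forall M N r, M0 <= M -> M <= N -> M^-1 <= r ->
  r `^ (mu + nu) * `|\int[leb]_(t in `[M, N]) (g t * ker r t)| <= e.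
Proof.
move=> e0; have [C C0 [G dG GC]] := bessel_primitive alpha_ge nu.
(* The 2 accounts for the boundary terms at [M] and [N], the rest for the integral against the
   variation; [C + 1] is used because [C] may be 0. *)
pose c : R := (C + 1) * (2 + 4 * 2 `^ `|be|).
have C1 : 0 < C + 1 by rewrite ltr_wpDl.
have c0 : 0 < c by rewrite mulr_gt0// addr_gt0// mulr_gt0// powR_gt0.
pose d := e / c; have d0 : 0 < d by rewrite divr_gt0.
have [M1 M10 JM] := tv_integral_small d0.
have [M2 M20 gM] := vanishing_small d0.
exists (Num.max M1 M2) => [|M N r]; first by rewrite lt_max M10.
rewrite ge_max => /andP[M1M M2M] MN Mr.
have Mp : 0 < M := lt_le_trans M10 M1M.
have Np : 0 < N := lt_le_trans Mp MN.
have r0 : 0 < r by rewrite (lt_le_trans _ Mr)// invr_gt0.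
have rt t : M <= t -> 1 <= r * t.
  move=> Mt; have t0 := lt_le_trans Mp Mt.
  by rewrite -ler_pdivrMr// mul1r (le_trans _ Mr)// lef_pV2.
(* The primitive is made to vanish at the end where [t^be] is smallest, so that the maximum in [GC]
   is always the value at [t]. *)
pose b := if 0 <= be then M else N.
(* The power of [r] comes from the substitution [u = r * t]. *)
pose P t := r `^ (- nu - 1) * (G (r * t) + - G (r * b)).
have dP t : M <= t <= N -> is_derive t 1 P (ker r t).
  move=> /andP[Mt _]; have t0 := lt_le_trans Mp Mt.
  have drt := is_derive_mullf (is_derive_id t (1 : R)) r.
  have := is_derive_mullf (is_derive_addf (is_derive_compf drt (dG _ (rt t Mt)))
    (is_derive_cstf (- G (r * b)) t)) (r `^ (- nu - 1)).
  move=> dd; apply: (is_derive_eq dd) => {dd}.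
  rewrite addr0 powRM ?(ltW r0) ?(ltW t0)//.
  rewrite (_ : _ * _ = r `^ (- nu - 1) * r `^ nu * r `^ 1 * (ker r t)); last first.
    by rewrite powRr1 ?(ltW r0)//; ring.
  rewrite -!powRD ?(gt_eqF r0) ?implybT//.
  by rewrite (_ : _ + _ + _ = 0) ?powRr0 ?mul1r//; ring.
pose A := (C + 1) * r `^ (be - nu - 1).
have A0 : 0 < A by rewrite mulr_gt0// powR_gt0.
have PA t : M <= t <= N -> `|P t| <= A * t `^ be.
  move=> /andP[Mt tN]; have t0 := lt_le_trans Mp Mt.
  rewrite /P normrM ger0_norm ?powR_ge0//.
  have -> : A * t `^ be = r `^ (- nu - 1) * ((C + 1) * (r * t) `^ be).
    rewrite powRM ?(ltW r0) ?(ltW t0)// /A (_ : be - nu - 1 = be + (- nu - 1)); last by ring.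
    by rewrite powRD ?(gt_eqF r0) ?implybT//; ring.
  rewrite ler_wpM2l ?powR_ge0//.
  apply: (@le_trans _ _ (C * (r * t) `^ be)); last by rewrite ler_wpM2r ?powR_ge0// lerDl.
  have rt0 : 0 < r * t by rewrite mulr_gt0.
  rewrite /b; case: ifPn => [be0|].
    apply: le_trans (GC _ _ (rt M (lexx M)) _) _; first by rewrite ler_pM2l.
    rewrite ler_wpM2l// ge_max lexx andbT.
    by rewrite ge0_ler_powR ?nnegrE ?ler_pM2l// ltW// mulr_gt0.
  rewrite -ltNge => be0; rewrite distrC.
  apply: le_trans (GC _ _ (rt t Mt) _) _; first by rewrite ler_pM2l.
  rewrite ler_wpM2l// ge_max lexx/=.
  rewrite -(opprK be) !(powRN _ (- _)) lef_pV2 ?posrE ?powR_gt0 ?mulr_gt0//.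
  by rewrite ge0_ler_powR ?nnegrE ?ler_pM2l// ?ltW ?oppr_gt0// mulr_gt0.
have JMM := JM M M1M.
have Jfin : (J M < +oo)%E by apply: le_lt_trans JMM (ltry _).
have J0 : (0 <= J M)%E by apply: integral_ge0 => t _; rewrite lee_fin powR_ge0.
have fJ : fine (J M) <= d * M `^ kap.
  by rewrite -lee_fin fineK// ge0_fin_numE.
have ck t : M <= t <= N -> {for t, continuous (fun t => ker r t)}.
  by move=> /andP[Mt _]; apply: bessel_kernel_continuous => //; exact: lt_le_trans Mt.
have := Rintegral_variation_bound (bvf_from Mp) Mp Jfin MN A0 (g_int Mp MN) gf ck dP PA.
move=> H; apply: le_trans (ler_wpM2l (powR_ge0 r _) H) _.
have rA : r `^ (mu + nu) * A = (C + 1) * r `^ kap.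
  rewrite /A mulrCA -powRD ?(gt_eqF r0) ?implybT//.
  by congr (_ * _ `^ _); field.
rewrite (mulrA (r `^ (mu + nu)) A) rA -(mulrA (C + 1)).
(* Uniformity in [r] comes from [(r * x)^kap <= 1], valid since [1 <= r * x] and [kap <= 0]. *)
have term x y : M <= x -> 0 <= y -> y <= d * x `^ kap -> r `^ kap * y <= d.
  move=> Mx y0 yd; have x0 := lt_le_trans Mp Mx.
  apply: le_trans (ler_wpM2l (powR_ge0 _ _) yd) _.
  rewrite mulrCA -powRM ?(ltW r0) ?(ltW x0)// ger_pMr//.
  rewrite -(opprK kap) powRN invf_le1 ?powR_gt0 ?mulr_gt0//.
  rewrite -[leLHS](powRr0 (r * x)) ler_powR ?rt// oppr_ge0.
  exact: kap_le0.
have gterm x : M <= x -> r `^ kap * (`|g x| * x `^ be) <= d.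
  move=> Mx; have x0 := lt_le_trans Mp Mx.
  apply: (term x) => //; first by rewrite mulr_ge0 ?powR_ge0.
  apply: le_trans (ler_wpM2r (powR_ge0 _ _) (gM x (le_trans M2M Mx))) _.
  rewrite -mulrA ler_wpM2l ?(ltW d0)// -powRD ?(gt_eqF x0) ?implybT//.
  by rewrite le_eqVlt; apply/orP; left; apply/eqP; congr (_ `^ _); field.
have := gterm N MN; have := gterm M (lexx M); have := term M _ (lexx M) (fine_ge0 J0) fJ.
have b0 : 0 < 2 `^ `|be| :> R by rewrite powR_gt0.
set X := r `^ kap; set a1 := _ * N `^ be; set a2 := _ * M `^ be; set j := fine _.
move=> Xj Xa2 Xa1.
apply: (@le_trans _ _ ((C + 1) * (d + d + 4 * (2 `^ `|be| * d)))).
  rewrite ler_pM2l// (_ : X * _ = X * a1 + X * a2 + 4 * (2 `^ `|be| * (X * j))); last by ring.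
  by rewrite lerD// ?lerD// ler_pM2l// ler_pM2l.
rewrite (_ : _ * _ = d * c); last by rewrite /c; ring.
by rewrite /d divfK ?gt_eqF.
Qed.

(** Where [r * t <= 1] the Bessel factor is at most [B]. With [|g t| <= d * t^(mu - 1)], the choice
    of [d] bounds the integrand by the derivative of [e * t^(mu + nu)], and the result is at most
    [e * (r * N)^(mu + nu) <= e]. *)
Lemma low_frequency_small e : 0 < e -> exists2 M0 : R, 0 < M0 &
  forall M N r, M0 <= M -> M <= N -> 0 < r -> r * N <= 1 ->
  r `^ (mu + nu) * `|\int[leb]_(t in `[M, N]) (g t * ker r t)| <= e.
Proof.
move=> e0; have [B B0 phiB] := bessel_phi_bounded alpha_ge.
have B1 : 0 < B + 1 by rewrite ltr_wpDl.
pose d := e * (mu + nu) / (B + 1).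
have d0 : 0 < d by rewrite divr_gt0// mulr_gt0.
have [M0 M00 gM] := vanishing_small d0.
exists M0 => // M N r M0M MN r0 rN.
have Mp : 0 < M := lt_le_trans M00 M0M.
have Np : 0 < N := lt_le_trans Mp MN.
pose h t := e * ((mu + nu) * t `^ (mu + nu - 1)).
have pos t : M <= t <= N -> 0 < t by move=> /andP[Mt _]; exact: lt_le_trans Mt.
have ch t : M <= t <= N -> {for t, continuous h}.
  by move=> /pos t0; do 2 apply: cvgMr; exact: powR_continuous_at.
have dh t : M <= t <= N -> is_derive t 1 (fun t => e * t `^ (mu + nu)) (h t).
  by move=> /pos t0; exact: is_derive_mullf (is_derive1_powR (mu + nu) t0) e.
have ck t : M <= t <= N -> {for t, continuous (fun t => ker r t)}.
  by move=> /pos t0; exact: bessel_kernel_continuous.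
have [B' B'0 kB] := continuous_itv_bounded MN ck.
have ik : leb.-integrable `[M, N] (EFin \o (fun t => g t * ker r t)).
  apply: (integrableM_bounded _ (g_int Mp MN) (B := B')) => //.
  exact: continuous_itv_measurable.
apply: (@le_trans _ _ (r `^ (mu + nu) * (e * N `^ (mu + nu)))); last first.
  rewrite mulrCA -powRM ?(ltW r0) ?(ltW Np)// ger_pMr//.
  have := @ge0_ler_powR R _ (ltW munu_gt0) (r * N) 1; rewrite powR1; apply => //.
  - by rewrite nnegrE mulr_ge0 ?(ltW r0) ?(ltW Np).
  - by rewrite nnegrE.
rewrite ler_wpM2l ?powR_ge0//.
apply: le_trans (le_normr_Rintegral _ ik) _ => //.
apply: (@le_trans _ _ (\int[leb]_(t in `[M, N]) h t)).
  apply: le_Rintegral => //.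
  - exact: integrable_norm ik.
  - exact: continuous_itv_integrable.
  - move=> t /=; rewrite in_itv/= => tMN; have t0 := pos t tMN.
    have [Mt tN] := andP tMN.
    rewrite !normrM (ger0_norm (powR_ge0 t nu)).
    have rt1 : 0 <= r * t <= 1.
      by rewrite mulr_ge0 ?(ltW r0) ?(ltW t0)//= (le_trans _ rN)// ler_pM2l.
    apply: (@le_trans _ _ (d * t `^ (mu - 1) * (t `^ nu * (B + 1)))).
      rewrite ler_pM ?mulr_ge0 ?powR_ge0//; first exact/gM/(le_trans M0M).
      by rewrite ler_wpM2l ?powR_ge0// (le_trans (phiB _ rt1))// lerDl.
    rewrite (_ : _ * _ = d * (B + 1) * (t `^ (mu - 1) * t `^ nu)); last by ring.
    rewrite -powRD ?(gt_eqF t0) ?implybT// /d divfK ?gt_eqF// /h -mulrA.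
    by rewrite (_ : mu - 1 + nu = mu + nu - 1)//; ring.
have := Rintegral_is_derive MN dh ch => ->.
by rewrite gerBl mulr_ge0 ?(ltW e0) ?powR_ge0.
Qed.

Lemma partial_transform_cauchy e : 0 < e -> exists2 M0 : R, 0 < M0 &
  forall M N r, M0 <= M -> M <= N -> 0 <= r ->
  r `^ (mu + nu) * `|\int[leb]_(t in `[M, N]) (g t * ker r t)| <= e.
Proof.
move=> e0; have e20 : 0 < e / 2 by rewrite divr_gt0.
have [M1 M10 high] := high_frequency_small e20.
have [M2 M20 low] := low_frequency_small e20.
exists (Num.max M1 M2) => [|M N r]; first by rewrite lt_max M10.
rewrite ge_max => /andP[M1M M2M] MN.
rewrite le_eqVlt => /predU1P[<-|r0].
  (* At [r = 0] the prefactor is 0 because its exponent is nonzero; [0^0] would be 1. *)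
  by rewrite powR0 ?mul0r ?ltW// gt_eqF.
have Mp : 0 < M := lt_le_trans M10 M1M.
have ee : e / 2 <= e by lra.
have [Mr|rM] := leP M^-1 r; first exact: le_trans (high M N r M1M MN Mr) ee.
have [rN|Nr] := leP (r * N) 1; first exact: le_trans (low M N r M2M MN r0 rN) ee.
have Mr1 : M <= r^-1 by rewrite -[M]invrK lef_pV2 ?posrE ?invr_gt0// ltW.
have rN1 : r^-1 <= N by rewrite -div1r ler_pdivrMr// mulrC ltW.
have ck t : M <= t <= N -> {for t, continuous (fun t => ker r t)}.
  by move=> /andP[Mt _]; apply: bessel_kernel_continuous => //; exact: lt_le_trans Mt.
have [B' B'0 kB] := continuous_itv_bounded MN ck.
have ik : leb.-integrable `[M, N] (EFin \o (fun t => g t * ker r t)).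
  apply: (integrableM_bounded _ (g_int Mp MN) (B := B')) => //.
  exact: continuous_itv_measurable.
have split_int : \int[leb]_(t in `[M, N]) (g t * ker r t) =
    \int[leb]_(t in `[M, r^-1]) (g t * ker r t)
    + \int[leb]_(t in `[r^-1, N]) (g t * ker r t).
  rewrite -[X in _ = _ + X]Rintegral_itv_obnd_cbnd; last first.
    by apply: integrableS ik => //; apply: subset_itv; rewrite bnd_simp.
  by rewrite -(Rintegral_itvB ik) ?bnd_simp// addrC subrK.
rewrite split_int; apply: le_trans (ler_wpM2l (powR_ge0 _ _) (ler_normD _ _)) _.
rewrite mulrDr (_ : e = e / 2 + e / 2); last by field.
apply: lerD.
  by apply: low => //; rewrite divff ?gt_eqF.
apply: high => //; first exact: le_trans Mr1.
by rewrite invrK.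
Qed.

End real_function.

End real_estimates.

(** * Complex values through real and imaginary parts *)

Section complex_modulus.
Context {R : realType}.
Implicit Types (z : R[i]) (a b : R).

Lemma normr_Re_le z : `|complex.Re z| <= Normc.normc z.
Proof.
by case: z => a b /=; rewrite -sqrtr_sqr ler_wsqrtr// lerDl sqr_ge0.
Qed.

Lemma normr_Im_le z : `|complex.Im z| <= Normc.normc z.
Proof.
by case: z => a b /=; rewrite -sqrtr_sqr ler_wsqrtr// lerDr sqr_ge0.
Qed.

Lemma normc_le_add a b : Normc.normc (a +i* b) <= `|a| + `|b|.
Proof.
rewrite /= -[leRHS]ger0_norm ?addr_ge0// -sqrtr_sqr ler_wsqrtr//.
rewrite sqrrD !real_normK ?num_real// addrAC lerDl.
by rewrite mulrn_wge0// mulr_ge0.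
Qed.

(** Radii of balls in [R[i]] are themselves complex; the order forces a zero imaginary part. *)
Lemma posC_gt0 (e : R[i]) : 0 < e -> exists2 d : R, 0 < d & e = d%:C.
Proof.
case: e => a b; rewrite ltcE/= => /andP[/eqP -> a0]; exists a => //.
Qed.

Lemma cvg_complex (u v : R -> R) (F : set_system R) a b : Filter F ->
  u x @[x --> F] --> a -> v x @[x --> F] --> b ->
  (u x +i* v x : R[i]^o) @[x --> F] --> (a +i* b : R[i]^o).
Proof.
move=> FF ua vb; apply/cvgrPdist_lt => _ /posC_gt0[e e0 ->].
have e20 : 0 < e / 2 by rewrite divr_gt0.
move/cvgrPdist_lt: ua => /(_ _ e20) ua; move/cvgrPdist_lt: vb => /(_ _ e20) vb.
near=> x; rewrite -[`|_|]/((Normc.normc _)%:C) ltcR.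
apply: le_lt_trans (normc_le_add _ _) _.
rewrite [e]splitr ltrD//; near: x; [exact: ua|exact: vb].
Unshelve. all: by end_near. Qed.

End complex_modulus.

(** * Partial integrals from 0 and the passage from Cauchy estimates to uniform limits *)

Section partial_integrals.
Context {R : realType}.
Local Notation leb := lebesgue_measure.

Lemma integrable_setU (A B : set (measurableTypeR R)) (g : R -> \bar R) :
  measurable A -> measurable B -> [disjoint A & B] ->
  leb.-integrable A g -> leb.-integrable B g -> leb.-integrable (A `|` B) g.
Proof.
move=> mA mB AB /integrableP[mgA gA] /integrableP[mgB gB].
have mg : measurable_fun (A `|` B) g by apply/measurable_funU.
apply/integrableP; split => //.
rewrite ge0_integral_setU//; first exact: lte_add_pinfty.
exact: measurableT_comp.
Qed.

Variables (alpha nu mu : R) (g : R -> R).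
Hypothesis alpha_ge : - (1 / 2) <= alpha.
Hypothesis g01 : leb.-integrable `]0, 1[ (EFin \o (fun t => t `^ nu * g t)).
Hypothesis g_int : forall M N, 0 < M -> M <= N -> leb.-integrable `[M, N] (EFin \o g).

Local Notation ker r t := (t `^ nu * bessel_phi alpha ((r * t) ^+ 2)).

Definition real_partial_transform (N r : R) : R :=
  r `^ (mu + nu) * \int[leb]_(t in `]0, N[) (g t * ker r t).

(** On []0, 1[] the integrable factor is [t^nu * g t] and the Bessel factor is bounded; on [[1, N[]
    it is [g] alone, and the whole kernel is bounded. *)
Lemma integrable_kernel r N : 1 <= N ->
  leb.-integrable `]0, N[ (EFin \o (fun t => g t * ker r t)).
Proof.
move=> N1.
have -> : `]0, N[%classic = `]0, 1[%classic `|` `[1, N[%classic.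
  by rewrite -itv_bndbnd_setU// bnd_simp.
have cphi t : {for t, continuous (fun t => bessel_phi alpha ((r * t) ^+ 2))}.
  apply: (cvg_comp (fun t => r * t) (fun z => bessel_phi alpha (z ^+ 2))).
    by apply: cvgMr; exact: cvg_id.
  exact: bessel_phi_sqr_continuous.
apply: integrable_setU.
- exact: measurable_itv.
- exact: measurable_itv.
- apply/disj_setPS => t [/=]; rewrite !in_itv/= => /andP[_ t1] /andP[t2 _].
  by move: (lt_le_trans t1 t2); rewrite ltxx.
- have [B B0 phiB] := continuous_itv_bounded (@ler01 R) (fun t _ => cphi t).
  rewrite (_ : (fun t => g t * ker r t) =
    (fun t => t `^ nu * g t * bessel_phi alpha ((r * t) ^+ 2))); last first.
    by apply/funext => t; ring.
  apply: (integrableM_bounded _ g01 (B := B)) => //.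
    exact: continuous_itv_measurable.
  move=> t /=; rewrite in_itv/= => /andP[t0 t1]; apply: phiB.
  by rewrite !ltW.
- have ck t : 1 <= t <= N -> {for t, continuous (fun t => ker r t)}.
    move=> /andP[t1 _]; apply: bessel_kernel_continuous => //.
    exact: lt_le_trans ltr01 t1.
  have [B B0 kB] := continuous_itv_bounded N1 ck.
  have kN : leb.-integrable `[1, N] (EFin \o (fun t => g t * ker r t)).
    apply: (integrableM_bounded _ (g_int ltr01 N1) (B := B)) => //.
    exact: continuous_itv_measurable.
  by apply: integrableS kN => //; apply: subset_itv; rewrite bnd_simp.
Qed.

Lemma real_partial_transformB r M N : 1 <= M -> M <= N ->
  real_partial_transform N r - real_partial_transform M r =
  r `^ (mu + nu) * \int[leb]_(t in `[M, N]) (g t * ker r t).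
Proof.
move=> M1 MN; have N1 := le_trans M1 MN; have M0 := lt_le_trans ltr01 M1.
have iN := integrable_kernel r N1.
have iM := integrable_kernel r M1.
rewrite /real_partial_transform -mulrBr; congr (_ * _).
have -> : `]0, N[%classic = `]0, M[%classic `|` `[M, N[%classic.
  by rewrite -itv_bndbnd_setU// bnd_simp.
rewrite Rintegral_setU//.
- rewrite addrAC subrr add0r Rintegral_itv_bndo_bndc//.
  by apply: integrableS iN => //; apply: subset_itv; rewrite bnd_simp.
- by rewrite -itv_bndbnd_setU// bnd_simp.
- apply/disj_setPS => t [/=]; rewrite !in_itv/= => /andP[_ t1] /andP[t2 _].
  by move: (lt_le_trans t1 t2); rewrite ltxx.
Qed.

Hypothesis cauchy : forall e, 0 < e -> exists2 M0 : R, 0 < M0 &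
  forall M N r, M0 <= M -> M <= N -> 0 <= r ->
  r `^ (mu + nu) * `|\int[leb]_(t in `[M, N]) (g t * ker r t)| <= e.

(** Completeness gives the limit for each [r]; letting [N] tend to infinity in the Cauchy estimate
    keeps the threshold [M0] independent of [r]. *)
Lemma real_transform_uniform : exists L : R -> R,
  (forall r, 0 <= r -> real_partial_transform N r @[N --> +oo] --> L r) /\
  (forall e, 0 < e -> exists2 M0 : R, 0 < M0 & forall M r, M0 <= M -> 0 <= r ->
     `|L r - real_partial_transform M r| <= e).
Proof.
have dist e : 0 < e -> exists2 M0 : R, 0 < M0 & forall M N r, M0 <= M -> M <= N ->
    0 <= r -> `|real_partial_transform N r - real_partial_transform M r| <= e.
  move=> e0; have [M0 M00 H] := cauchy e0.
  exists (Num.max M0 1) => [|M N r]; first by rewrite lt_max M00.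
  rewrite ge_max => /andP[M0M M1] MN r0; rewrite real_partial_transformB//.
  by rewrite normrM ger0_norm ?powR_ge0// H.
have cv r : 0 <= r -> cvg (real_partial_transform N r @[N --> +oo]).
  move=> r0; apply: cauchy_cvg; apply: cauchy_exP => e e0.
  have e20 : 0 < e / 2 by rewrite divr_gt0.
  have [M0 M00 H] := dist _ e20; exists (real_partial_transform M0 r).
  suff : \forall N \near +oo, ball (real_partial_transform M0 r) e
    (real_partial_transform N r) by [].
  near=> N; rewrite /ball/= distrC; apply: (@le_lt_trans _ _ (e / 2)); last lra.
  by apply: H => //; near: N; apply: nbhs_pinfty_ge; exact: num_real.
exists (fun r => lim (real_partial_transform N r @[N --> +oo])); split => [r /cv//|e e0].
have [M0 M00 H] := dist _ e0; exists M0 => // M r M0M r0.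
have c1 : `|real_partial_transform N r - real_partial_transform M r| @[N --> +oo] -->
    `|lim (real_partial_transform N r @[N --> +oo]) - real_partial_transform M r|.
  by apply: cvg_norm; apply: cvgB; [exact: cv|exact: cvg_cst].
rewrite -(cvg_lim (@Rhausdorff R) c1); apply: limr_le.
  by apply/cvg_ex; eexists; exact: c1.
near=> N; apply: H => //; near: N; apply: nbhs_pinfty_ge; exact: num_real.
Unshelve. all: by end_near. Qed.

End partial_integrals.

(** * The complex transform, by reduction to real and imaginary parts *)

Unset Implicit Arguments.
Set Strict Implicit.
Set Printing Implicit Defensive.

Theorem theorem5p2 (R : realType) (alpha nu mu : R) (f : R -> R[i])
  (halpha : - (1 / 2) <= alpha)
  (hmunu0 : 0 < mu + nu) (hmunu : mu + nu <= alpha + 3 / 2)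
  (hbv : locally_bounded_variation f)
  (hloc : clocally_integrable `]0, +oo[ f)
  (hvan : vanishing_at_infinity f)
  (hL1 : cintegrable `]0, 1[ (fun t => (t `^ nu)%:C * f t))
  (hdf1 : nu < alpha + 1 / 2 -> mu < 1 ->
    ereal_littleo (fun M => tv_integral f M (fun=> 1)) (fun M => M `^ (mu - 1)))
  (hdf2 : alpha + 1 / 2 <= nu \/ 1 <= mu ->
    ereal_littleo
      (fun M => tv_integral f M (fun t => t `^ (nu - alpha - 1 / 2)))
      (fun M => M `^ (mu + nu - alpha - 3 / 2))) :
  transform_cvg_uniformly alpha nu mu f [set r | 0 <= r].
Proof.
have loc_int (g : R -> R) : locally_integrable `]0, +oo[ g ->
    forall M N, 0 < M -> M <= N -> lebesgue_measure.-integrable `[M, N] (EFin \o g).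
  move=> [mg _ gK] M N M0 MN.
  have sub : `[M, N] `<=` `]0, +oo[.
    by move=> t /=; rewrite !in_itv/= andbT => /andP[Mt _]; exact: lt_le_trans Mt.
  apply/integrableP; split.
    by apply/measurable_EFinP; apply: measurable_funS sub mg.
  exact: (gK _ sub (@segment_compact _ _ _)).
(* Stated for any real [g] whose increments and size are dominated by those of [f], so that both
   parts of [f] use the same variation measure. *)
have unif (g : R -> R) : (forall x y, `|g y - g x| <= Normc.normc (f y - f x)) ->
    (forall t, `|g t| <= Normc.normc (f t)) ->
    locally_integrable `]0, +oo[ g ->
    lebesgue_measure.-integrable `]0, 1[ (EFin \o (fun t => t `^ nu * g t)) ->
    exists L : R -> R,
    (forall r, 0 <= r -> real_partial_transform alpha nu mu g N r @[N --> +oo] --> L r) /\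
    (forall e, 0 < e -> exists2 M0 : R, 0 < M0 & forall M r, M0 <= M -> 0 <= r ->
       `|L r - real_partial_transform alpha nu mu g M r| <= e).
  move=> gf gn gloc g01; apply: real_transform_uniform => //; first exact: loc_int.
  apply: (@partial_transform_cauchy _ alpha nu mu f) => //; last exact: loc_int.
  apply/cvgrPdist_le => e e0.
  have e0' : 0 < e%:C by rewrite ltcR.
  move/cvgrPdist_le: hvan => /(_ _ e0').
  apply: filterS => t; rewrite !sub0r !normrN -[X in X <= _]/((Normc.normc _)%:C) lecR.
  exact: le_trans (gn t).
have [|||| LR [cR uR]] := unif (fun t => complex.Re (f t)).
- move=> x y; apply: le_trans (normr_Re_le _).
  by case: (f x) => a b; case: (f y) => c d.
- by move=> t; exact: normr_Re_le.
- by case: hloc.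
- case: hL1 => + _; congr (_.-integrable _ _); apply/funext => t /=.
  by case: (f t) => a b /=; rewrite mul0r subr0.
have [|||| LI [cI uI]] := unif (fun t => complex.Im (f t)).
- move=> x y; apply: le_trans (normr_Im_le _).
  by case: (f x) => a b; case: (f y) => c d.
- by move=> t; exact: normr_Im_le.
- by case: hloc.
- case: hL1 => _; congr (_.-integrable _ _); apply/funext => t /=.
  by case: (f t) => a b /=; rewrite mul0r addr0.
have ptE N r : 0 <= r -> partial_transform alpha nu mu f N r =
    real_partial_transform alpha nu mu (fun t => complex.Re (f t)) N r
    +i* real_partial_transform alpha nu mu (fun t => complex.Im (f t)) N r.
  move=> r0; rewrite /partial_transform /cintegral /real_partial_transform.
  rewrite [LHS]/GRing.mul/= !mul0r subr0 addr0.
  congr (_ * _ +i* (_ * _)); apply: eq_Rintegral => t /set_mem/=;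
    rewrite in_itv/= => /andP[t0 _]; rewrite bessel_jE ?mulr_ge0 ?(ltW t0)//;
    case: (f t) => a b /=; ring.
have tE r : 0 <= r -> transform alpha nu mu f r = LR r +i* LI r.
  move=> r0; apply: cvg_lim; first exact: norm_hausdorff.
  have -> : (fun N => partial_transform alpha nu mu f N r) = (fun N =>
      real_partial_transform alpha nu mu (fun t => complex.Re (f t)) N r
      +i* real_partial_transform alpha nu mu (fun t => complex.Im (f t)) N r).
    by apply/funext => N; exact: ptE.
  by apply: cvg_complex; [exact: cR|exact: cI].
move=> P /uniform_nbhs[E [entE EP]].
move: entE; rewrite -entourage_ballE => -[e /posC_gt0[d d0 ->] dE].
(* Two errors of [d / 3] add up to strictly less than [d], as membership in the open ball
   requires. *)
have d30 : 0 < d / 3 by rewrite divr_gt0.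
have [M1 M10 HR] := uR _ d30; have [M2 M20 HI] := uI _ d30.
suff : \forall N \near +oo, P (partial_transform alpha nu mu f N) by [].
near=> N; apply: EP => /= r r0; apply: dE => /=.
rewrite tE// ptE// -ball_normE/= -[`|_|]/((Normc.normc _)%:C) ltcR.
apply: le_lt_trans (normc_le_add _ _) _.
apply: (@le_lt_trans _ _ (d / 3 + d / 3)); last lra.
apply: lerD; [apply: HR => //|apply: HI => //]; near: N;
  apply: nbhs_pinfty_ge; exact: num_real.
Unshelve. all: by end_near. Qed.
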